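(* Let $A$ be a scalar type spectral operator in a complex Banach space $(X,\|\cdot\|)$ with $\sigma(A)\subseteq i\mathbb{R}$. Then the strongly continuous group $\{e^{tA}\}_{t\in\mathbb{R}}$ of bounded linear operators generated by $A$ is bounded, i.e., $\sup_{t\in\mathbb{R}}\|e^{tA}\|<\infty$, and hence it is non-hypercyclic, i.e., there is no nonzero vector $f\in X$ whose orbit $\{e^{tA}f\}_{t\in\mathbb{R}}$ is dense in $X$.
   Context: Here $i$ is the imaginary unit and $\sigma(A)$ is the spectrum of $A$. The norm of operators is the operator norm on the space of bounded linear operators on $X$. Hypercyclicity. A collection $\{T(t)\}_{t\in J}$ ($J$ a nonempty index set) of linear operators in $X$ is hypercyclic if there is a nonzero $f\in\bigcap_{t\in J}D(T(t))$ whose orbit $\{T(t)f\}_{t\in J}$ is dense in $X$; non-hypercyclic means not hypercyclic. Scalar type spectral operators (in the sense of Dunford). A spectral measure $E$ on $X$ is a map from the Borel subsets of $\mathbb{C}$ to bounded linear projections on $X$ with $E(\emptyset)=0$, $E(\mathbb{C})=I$, $E(\delta\cap\sigma)=E(\delta)E(\sigma)$ for all Borel sets $\delta,\sigma$, and countably additive in the strong operator topology. For a bounded Borel function $F$, $\int F\,dE$ is the bounded operator obtained as the operator-norm limit of integrals of simple functions converging uniformly to $F$. For an arbitrary Borel function $F$, put $F_n:=F\cdot\chi_{\{|F|\le n\}}$ ($\chi_\delta$ is the characteristic function of the set $\delta$), and let $\int F\,dE$ be the operator with domain $\{f\in X\mid \lim_{n\to\infty}\int F_n\,dE\,f \text{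 exists in } X\}$ whose value at such an $f$ is this limit. A (bounded or unbounded) operator $A$ in $X$ is a scalar type spectral operator if there is a spectral measure $E=E_A$ such that $A=\int\lambda\,dE_A(\lambda)$, with equality of domains; the support of $E_A$ is $\sigma(A)$. One defines $e^{tA}:=\int_{\sigma(A)}e^{t\lambda}\,dE_A(\lambda)$ for $t\in\mathbb{R}$. When $\sigma(A)\subseteq\{\lambda\in\mathbb{C}\mid -\omega\le\operatorname{Re}\lambda\le\omega\}$ for some $\omega\ge 0$ (in particular, when $\sigma(A)\subseteq i\mathbb{R}$), the collection $\{e^{tA}\}_{t\in\mathbb{R}}$ coincides with the strongly continuous group of bounded linear operators generated by $A$. *)

(* Defs.v *)
From HB Require Import structures.
From mathcomp Require Import all_boot all_order all_algebra.
From mathcomp Require Import all_classical all_reals all_analysis.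
From mathcomp Require Import complex.

Set Implicit Arguments.
Unset Strict Implicit.
Unset Printing Implicit Defensive.

Import Order.TTheory GRing.Theory Num.Theory.
Import numFieldNormedType.Exports.

Local Open Scope classical_set_scope.
Local Open Scope complex_scope.
Local Open Scope ring_scope.

(* The topology of the complex plane is carried by the alias R[i]^o. *)
Notation borelC R := (g_sigma_algebraType (@open (R[i])^o)).

Definition borel_set (R : realType) (d : set R[i]) : Prop :=
  measurable (d : set (borelC R)).

Definition borel_fun (R : realType) (F : R[i] -> R[i]) : Prop :=
  measurable_fun [set: borelC R] (F : borelC R -> borelC R).

Definition cexp (R : realType) (z : R[i]) : R[i] :=
  (expR (complex.Re z) * cos (complex.Im z)) +i*
  (expR (complex.Re z) * sin (complex.Im z)).

Section Operators.
Variables (R : realType) (X : normedModType R[i]).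

(* An operator in X is given by its domain and a total function on X; only the
   values on the domain are meaningful, see eq_operator. *)
Record operator := Operator { dom : set X ; opfun :> X -> X }.

Definition linear_operator (A : operator) : Prop :=
  dom A 0 /\
  forall (a : R[i]) (f g : X), dom A f -> dom A g ->
    dom A (a *: f + g) /\ A (a *: f + g) = a *: A f + A g.

Definition eq_operator (A B : operator) : Prop :=
  dom A = dom B /\ forall f, dom A f -> A f = B f.

(* The norm of X takes its values in R[i] and is a nonnegative real there,
   whence the real part. *)
Definition opnorm (T : X -> X) : \bar R :=
  ereal_sup [set (complex.Re `|T f|)%:E | f in [set f : X | `|f| <= 1]].

Definition bounded_linear (T : X -> X) : Prop :=
  linear T /\ (opnorm T < +oo)%E.

Definition spectrum (A : operator) : set R[i] :=
  ~` [set l | exists Q : X -> X,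
    [/\ bounded_linear Q,
        (forall f, dom A (Q f) /\ A (Q f) - l *: Q f = f) &
        (forall f, dom A f -> Q (A f - l *: f) = f)]].

Definition hypercyclic (J : Type) (T : J -> operator) : Prop :=
  exists f : X, [/\ f != 0, (forall t, dom (T t) f) &
                    dense [set T t f | t in [set: J]]].

Definition c0_group (T : R -> operator) : Prop :=
  [/\ forall t, dom (T t) = setT /\ bounded_linear (T t),
      (forall f, T 0 f = f),
      (forall s t f, T (s + t) f = T s (T t f)) &
      (forall f, continuous (fun t : R => T t f))].

Definition generator (T : R -> operator) : operator :=
  Operator [set f | cvg ((h^-1)%:C *: (T h f - f) @[h --> 0^'])]
           (fun f => lim ((h^-1)%:C *: (T h f - f) @[h --> 0^'])).

End Operators.

Section SpectralIntegral.
Variables (R : realType) (X : normedModType R[i]).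
Implicit Types (E : set R[i] -> X -> X) (F s : R[i] -> R[i]).

(* The values of E outside the Borel sets are irrelevant. *)
Record spectral_measure E : Prop := SpectralMeasure {
  spectral_measure_bounded : forall d, borel_set d -> bounded_linear (E d) ;
  spectral_measure_proj : forall d, borel_set d ->
    forall f, E d (E d f) = E d f ;
  spectral_measure0 : forall f, E set0 f = 0 ;
  spectral_measureT : forall f, E setT f = f ;
  spectral_measureI : forall d e, borel_set d -> borel_set e ->
    forall f, E (d `&` e) f = E d (E e f) ;
  spectral_measure_sigma_additive : forall d : nat -> set R[i],
    (forall n, borel_set (d n)) -> trivIset setT d ->
    forall f, \sum_(k < n) E (d k) f @[n --> \oo] --> E (\bigcup_n d n) f }.

Definition simple_fun s : Prop := borel_fun s /\ finite_set (range s).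

Definition simple_integral E s (f : X) : X :=
  \sum_(c \in range s) c *: E (s @^-1` [set c]) f.

Definition is_bounded_integral E F (T : X -> X) : Prop :=
  bounded_linear T /\
  exists s_ : nat -> R[i] -> R[i],
    [/\ forall n, simple_fun (s_ n),
        (forall e : R, 0 < e -> \forall n \near \oo,
           forall z, `|s_ n z - F z| < e%:C) &
        opnorm (fun f => simple_integral E (s_ n) f - T f) @[n --> \oo]
          --> 0%E].

(* Meaningful for a bounded Borel function F (0 if no such limit exists). *)
Definition bounded_integral E F : X -> X :=
  xget (fun=> 0) [set T | is_bounded_integral E F T].

Definition truncation F (n : nat) : R[i] -> R[i] :=
  fun z => F z * \1_[set w | `|F w| <= n%:R] z.

Definition spectral_integral E F : operator X :=
  Operator
    [set f | cvg (bounded_integral E (truncation F n) f @[n --> \oo])]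
    (fun f => lim (bounded_integral E (truncation F n) f @[n --> \oo])).

Definition spectral_integral_on E (d : set R[i]) F : operator X :=
  spectral_integral E (fun z => F z * \1_d z).

(* A is a scalar type spectral operator with spectral measure E_A = E. *)
Definition scalar_type_spectral (A : operator X) E : Prop :=
  [/\ linear_operator A, spectral_measure E &
      eq_operator A (spectral_integral E id)].

(* e^{tA}, where E is the spectral measure of A *)
Definition exp_operator (A : operator X) E (t : R) : operator X :=
  spectral_integral_on E (spectrum A) (fun l => cexp (t%:C * l)).

End SpectralIntegral.

(* Main.v *)
(* The projections E d are uniformly bounded: for a fixed vector a set on which
   they are not bounded could be halved repeatedly, against continuity of E
   along monotone sequences of sets, and the uniform boundedness principle does
   the rest. By convexity in the coefficients, a simple function s then has an
   integral of norm at most C sup |s|, so that F |-> int F dE is a bounded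
   multiplicative functional calculus on uniform limits of simple functions.
   Disks around points of the resolvent set are E-null when small enough, hence
   E is carried by the spectrum; there |exp (t l)| = 1, which bounds the group
   and prevents its orbits from being dense. The generator is found from
   (exp (h l) - 1) / h = l (exp (h l) - 1) / (h l), where the last quotient is
   bounded on the imaginary axis and tends to 1 with h. *)
Require Import Defs.
From mathcomp Require Import all_boot all_order all_algebra.
From mathcomp Require Import all_classical all_reals all_analysis.
From mathcomp Require Import complex.
From mathcomp Require Import ring lra.
Import Order.TTheory GRing.Theory Num.Theory.
Import numFieldNormedType.Exports.
Local Open Scope classical_set_scope.
Local Open Scope ring_scope.
Set Implicit Arguments.
Unset Strict Implicit.

(** * The real-valued norm *)

(** The triangle inequality alone bounds the integral of a simple function by a multiple of the sum
    of the |c_k|, which grows with the number of values and is useless for uniform limits. Bounding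
    E on all Borel sets first removes the dependence on the partition. The second obstacle is an
    unbounded spectrum. There exp (t z) need not be continuous in t uniformly in z, and (exp (h z) -
    1) / (h z) need not tend to 1 uniformly; both limits are uniform only on disks. Strong
    convergence of E (disk n) to the identity, together with a common bound on the functions, fills
    this gap. The same disks give access to the unbounded operator A: if G and z G(z) are bounded
    with integrals S and U, then the n-th truncated integral of z composed with S is E (disk n)
    composed with U. This single identity yields the resolvents of A, the estimate of A on the range
    of E over a small disk, and the formula for the difference quotients of the group. *)

Notation toC x := (real_complex _ x).

(** Real-valued, so that estimates and [lra] run in the ordered field R instead of the partially
    ordered R[i]. *)
Definition rnorm (R : realType) (V : normedZmodType R[i]) (x : V) : R :=
  complex.Re `|x|.

Section Rnorm.
Variables (R : realType) (V : normedZmodType R[i]).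
Implicit Types x y : V.

Lemma rnormE x : `|x| = toC (rnorm x).
Proof. by rewrite /rnorm RRe_real// realE normr_ge0. Qed.

Lemma rnorm_ge0 x : 0 <= rnorm x.
Proof. by rewrite -lecR -rnormE normr_ge0. Qed.

Lemma rnorm0 : rnorm (0 : V) = 0.
Proof. by apply: complexI; rewrite -rnormE normr0. Qed.

Lemma rnorm_eq0 x : (rnorm x == 0) = (x == 0).
Proof.
by rewrite -(inj_eq (@complexI _)) -rnormE normr_eq0.
Qed.

Lemma ler_rnormD x y : rnorm (x + y) <= rnorm x + rnorm y.
Proof. by rewrite -lecR rmorphD /= -!rnormE ler_normD. Qed.

Lemma rnormN x : rnorm (- x) = rnorm x.
Proof. by rewrite /rnorm normrN. Qed.

Lemma rdistC x y : rnorm (x - y) = rnorm (y - x).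
Proof. by rewrite /rnorm distrC. Qed.

Lemma ler_rnormB x y : rnorm (x - y) <= rnorm x + rnorm y.
Proof. by rewrite -[rnorm y]rnormN ler_rnormD. Qed.

Lemma rdistD z x y : rnorm (x - y) <= rnorm (x - z) + rnorm (z - y).
Proof. by apply: le_trans (ler_rnormD _ _); rewrite addrA subrK. Qed.

Lemma ler_rnorm_sub x y : rnorm x - rnorm y <= rnorm (x - y).
Proof. by rewrite lerBlDr; apply: le_trans (ler_rnormD _ _); rewrite subrK. Qed.

End Rnorm.

Section RnormComplex.
Variable R : realType.
Implicit Types z w : R[i].

Lemma rnormM z w : rnorm (z * w) = rnorm z * rnorm w.
Proof. by apply: complexI; rewrite rmorphM /= -!rnormE normrM. Qed.

Lemma rnorm1 : rnorm (1 : R[i]) = 1.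
Proof. by apply: complexI; rewrite -rnormE normr1. Qed.

Lemma rnormV z : rnorm z^-1 = (rnorm z)^-1.
Proof. by apply: complexI; rewrite fmorphV /= -!rnormE normfV. Qed.

Lemma rnorm_toC (x : R) : rnorm (toC x) = `|x|.
Proof.
by rewrite /rnorm normc_def /= expr0n /= addr0 sqrtr_sqr.
Qed.

Lemma rnorm_sqr z : rnorm z ^+ 2 = complex.Re z ^+ 2 + complex.Im z ^+ 2.
Proof. by rewrite /rnorm normc_def /= sqr_sqrtr// addr_ge0// sqr_ge0. Qed.

Lemma Re_le_rnorm z : `|complex.Re z| <= rnorm z.
Proof.
rewrite -(@ler_pXn2r _ 2) ?nnegrE ?rnorm_ge0// rnorm_sqr real_normK ?num_real//.
by rewrite lerDl sqr_ge0.
Qed.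

Lemma Im_le_rnorm z : `|complex.Im z| <= rnorm z.
Proof.
rewrite -(@ler_pXn2r _ 2) ?nnegrE ?rnorm_ge0// rnorm_sqr.
by rewrite real_normK ?num_real// lerDr sqr_ge0.
Qed.

Lemma rnorm_le_ReIm z : rnorm z <= `|complex.Re z| + `|complex.Im z|.
Proof.
rewrite -(@ler_pXn2r _ 2) ?nnegrE ?rnorm_ge0 ?addr_ge0// rnorm_sqr sqrrD.
rewrite !real_normK ?num_real// addrAC lerDl.
by rewrite mulrn_wge0// mulr_ge0.
Qed.

Lemma rnormZ (X : normedModType R[i]) z (x : X) :
  rnorm (z *: x) = rnorm z * rnorm x.
Proof. by apply: complexI; rewrite rmorphM /= -!rnormE normrZ. Qed.

End RnormComplex.

Lemma gtc0_realE (R : realType) (e : R[i]) :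
  0 < e -> exists2 r : R, 0 < r & e = toC r.
Proof.
case: e => a b; rewrite ltcE /= => /andP[/eqP -> a0].
by exists a.
Qed.

Section Topology.
Variables (R : realType) (X : normedModType R[i]).

Lemma cvg_rnormP (T : Type) (F : set_system T) {FF : Filter F} (u : T -> X)
    (l : X) :
  u @ F --> l <-> forall e : R, 0 < e -> \forall t \near F, rnorm (l - u t) <= e.
Proof.
split.
  move=> /cvgrPdist_le h e e0.
  have := h (toC e); rewrite ltcR => /(_ e0).
  by apply: filterS => t; rewrite rnormE lecR.
move=> h; apply/cvgrPdist_le => _ /gtc0_realE[e e0 ->].
by have := h _ e0; apply: filterS => t; rewrite rnormE lecR.
Qed.

Lemma open_rnormP (U : set X) :
  open U <-> forall x, U x -> exists2 e : R, 0 < e &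
     forall y, rnorm (x - y) < e -> U y.
Proof.
split.
  move=> oU x Ux; have /nbhs_normP[_ /= /gtc0_realE[e e0 ->] he] : nbhs x U.
    exact: open_nbhs_nbhs.
  by exists e => // y xy; apply: he => /=; rewrite rnormE ltcR.
move=> h; rewrite openE => x Ux; have [e e0 he] := h x Ux.
apply/nbhs_normP; exists (toC e); first by rewrite /= ltcR.
by move=> y /=; rewrite rnormE ltcR; exact: he.
Qed.

End Topology.

Lemma cauchy_rnorm (R : realType) (X : completeNormedModType R[i])
    (u : nat -> X) :
  (forall e : R, 0 < e -> exists N, forall n, (N <= n)%N ->
     rnorm (u N - u n) <= e) -> cvg (u @ \oo).
Proof.
move=> h; apply: cauchy_cvg; apply: cauchy_exP => _ /gtc0_realE[e e0 ->].
have [//|N hN] := h (e / 2) _; first by rewrite divr_gt0.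
exists (u N), N => // n /= Nn; rewrite -ball_normE /= rnormE ltcR.
apply: le_lt_trans (hN _ Nn) _.
by rewrite ltr_pdivrMr// mulr_natr mulr2n ltrDl.
Qed.

(** * Bounded linear operators *)

Lemma exists_invS_le (R : realType) (e : R) : 0 < e ->
  exists n : nat, n.+1%:R^-1 <= e.
Proof.
move=> e0; exists (Num.truncn e^-1).
rewrite -lef_pV2 ?posrE ?invr_gt0 ?ltr0n// invrK.
by apply: ltW; rewrite truncnS_gt.
Qed.

Section BoundedLinear.
Variables (R : realType) (X : normedModType R[i]).
Implicit Types T : X -> X.

Lemma linear_fun0 T : linear T -> T 0 = 0.
Proof.
by move=> lT; have := lT (-1) 0 0; rewrite scaleN1r addr0 oppr0 scaleN1r addNr.
Qed.

Lemma linear_funD T x y : linear T -> T (x + y) = T x + T y.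
Proof. by move=> lT; have := lT 1 x y; rewrite !scale1r. Qed.

Lemma linear_funZ T a x : linear T -> T (a *: x) = a *: T x.
Proof. by move=> lT; have := lT a x 0; rewrite !addr0 linear_fun0// addr0. Qed.

Lemma linear_funN T x : linear T -> T (- x) = - T x.
Proof. by move=> lT; rewrite -scaleN1r linear_funZ// scaleN1r. Qed.

Lemma linear_funB T x y : linear T -> T (x - y) = T x - T y.
Proof. by move=> lT; rewrite linear_funD// linear_funN. Qed.

Lemma linear_fun_sum T I (r : seq I) (F : I -> X) : linear T ->
  T (\sum_(i <- r) F i) = \sum_(i <- r) T (F i).
Proof.
move=> lT; elim: r => [|i r IH]; first by rewrite !big_nil linear_fun0.
by rewrite !big_cons linear_funD// IH.
Qed.

Lemma opnorm_le T (b : R) : 0 <= b ->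
  (forall f, rnorm (T f) <= b * rnorm f) -> (opnorm T <= b%:E)%E.
Proof.
move=> b0 h; apply: ge_ereal_sup => _ /= [f f1 <-]; rewrite lee_fin.
apply: le_trans (h f) _; rewrite -[leRHS]mulr1 ler_wpM2l//.
by move: f1; rewrite rnormE -(rmorph1 (real_complex R)) lecR.
Qed.

Lemma opnorm_ge T f : rnorm f <= 1 -> ((rnorm (T f))%:E <= opnorm T)%E.
Proof.
move=> f1; apply: ereal_sup_ubound; exists f => //=.
by rewrite rnormE -(rmorph1 (real_complex R)) lecR.
Qed.

Lemma opnorm_ge0 T : (0 <= opnorm T)%E.
Proof.
apply: le_trans (opnorm_ge (f := 0) T _); last by rewrite rnorm0.
by rewrite lee_fin rnorm_ge0.
Qed.

Lemma le_opnorm T (b : R) : linear T -> (opnorm T <= b%:E)%E ->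
  forall f, rnorm (T f) <= b * rnorm f.
Proof.
move=> lT Tb f; have [->|f0] := eqVneq f 0.
  by rewrite linear_fun0// !rnorm0 mulr0.
have f1 : 0 < rnorm f by rewrite lt_neqAle rnorm_ge0 andbT eq_sym rnorm_eq0.
rewrite -ler_pdivrMr// -lee_fin; apply: le_trans Tb.
have -> : rnorm (T f) / rnorm f = rnorm (T (toC (rnorm f)^-1 *: f)).
  by rewrite linear_funZ// rnormZ rnorm_toC ger0_norm ?invr_ge0 ?rnorm_ge0// mulrC.
apply: opnorm_ge.
by rewrite rnormZ rnorm_toC ger0_norm ?invr_ge0 ?rnorm_ge0// mulVf ?gt_eqF.
Qed.

Lemma bounded_linearP T : bounded_linear T <->
  linear T /\ exists2 b : R, 0 <= b & forall f, rnorm (T f) <= b * rnorm f.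
Proof.
split=> [[lT]|[lT [b b0 h]]]; last first.
  by split=> //; apply: le_lt_trans (opnorm_le b0 h) _; rewrite ltry.
move=> Toy; split=> //; have := opnorm_ge0 T.
case E : (opnorm T) Toy => [b| |]// _; rewrite lee_fin => b0.
by exists b => //; apply: le_opnorm => //; rewrite E.
Qed.

End BoundedLinear.

(** * The uniform boundedness principle *)

Section UniformBoundedness.
Variables (R : realType) (X : completeNormedModType R[i]).
Variables (I : Type) (T : I -> X -> X).
Hypothesis bT : forall i, bounded_linear (T i).

(** Unboundedness gives some T i and a w of norm r / 2 with |T i w| >= n + 1. As 2 T i w = T i (x +
    w) - T i (x - w), one of x + w and x - w has an image at least as large, and it becomes the new
    center. *)
Let bumping (n : nat) (x : X) (r : R) :
  ~ (exists2 M : R, 0 <= M & forall i f, rnorm (T i f) <= M * rnorm f) ->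
  0 < r -> exists x' r' i,
  [/\ 0 < r', r' <= r / 2, r' <= n.+1%:R^-1, rnorm (x' - x) <= r / 2 &
      forall y, rnorm (y - x') <= r' -> n%:R <= rnorm (T i y)].
Proof.
move=> unb r0; have r20 : 0 < r / 2 by rewrite divr_gt0.
have [i [u uC]] : exists i u, n.+1%:R / (r / 2) * rnorm u < rnorm (T i u).
  apply: contrapT => h; apply: unb; exists (n.+1%:R / (r / 2)).
    by rewrite divr_ge0 ?ler0n// ltW.
  by move=> i f; rewrite leNgt; apply/negP => ?; apply: h; exists i, f.
have [lT [b b0 Tb]] := (bounded_linearP _).1 (bT i).
have u0 : 0 < rnorm u.
  rewrite lt_neqAle rnorm_ge0 andbT eq_sym rnorm_eq0; apply/eqP => u0.
  by move: uC; rewrite u0 linear_fun0// rnorm0 mulr0 ltxx.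
pose w := toC (r / 2 / rnorm u) *: u.
have c0 : 0 <= r / 2 / rnorm u by rewrite divr_ge0// ltW.
have wE : rnorm w = r / 2.
  by rewrite rnormZ rnorm_toC ger0_norm// divfK// gt_eqF.
have Tw : n.+1%:R <= rnorm (T i w).
  rewrite linear_funZ// rnormZ rnorm_toC ger0_norm// ltW//.
  move: uC; rewrite mulrAC ltr_pdivrMr// => uC.
  by rewrite mulrAC ltr_pdivlMr// [ltRHS]mulrC.
have [x' [x'x Tx']] : exists x', rnorm (x' - x) <= r / 2 /\
    n.+1%:R <= rnorm (T i x').
  have [h|h] := leP n.+1%:R (rnorm (T i (x + w))).
    by exists (x + w); rewrite [x + w]addrC addrK wE [w + x]addrC.
  exists (x - w); rewrite [in rnorm _ <= _]addrC addKr rnormN wE; split=> //.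
  have : rnorm (T i w + T i w) <= rnorm (T i (x + w)) + rnorm (T i (x - w)).
    apply: le_trans (ler_rnormB _ _).
    by rewrite linear_funD// linear_funB// opprB [T i x + _]addrC addrACA subrr addr0.
  rewrite -mulr2n -scaler_nat rnormZ -(rmorph_nat (real_complex R)) rnorm_toC.
  by rewrite ger0_norm//; move: h Tw; lra.
(* The bound r / 2 keeps the new ball inside the old one, (b + 1)^-1 keeps T i within 1 of its value
   at x', and n.+1^-1 makes the centers a Cauchy sequence. *)
exists x', (Num.min (r / 2) (Num.min (b + 1)^-1 n.+1%:R^-1)), i.
have b10 : 0 < b + 1 by rewrite ltr_wpDl.
split=> //.
- by rewrite !lt_min r20 !invr_gt0 b10 ltr0n.
- by rewrite ge_min lexx.
- by rewrite !ge_min lexx !orbT.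
move=> y; rewrite !le_min => /and3P[_ yx _].
have : rnorm (T i x') - rnorm (T i (x' - y)) <= rnorm (T i y).
  apply: le_trans (ler_rnorm_sub _ _) _.
  by rewrite linear_funB// opprB addrC subrK.
apply: le_trans.
have : rnorm (T i (x' - y)) <= 1.
  apply: le_trans (Tb _) _; rewrite rdistC.
  apply: le_trans (ler_wpM2l b0 yx) _.
  by rewrite ler_pdivrMr// mul1r lerDl.
by move: Tx'; rewrite -[n.+1]addn1 natrD; lra.
Qed.

(* Nested balls on the n-th of which some T i is at least n in norm: their
   common point contradicts pointwise boundedness. *)
Lemma uniform_boundedness :
  (forall f, exists M : R, forall i, rnorm (T i f) <= M) ->
  exists2 M : R, 0 <= M & forall i f, rnorm (T i f) <= M * rnorm f.
Proof.
move=> pw; apply: contrapT => unb.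
(* Positivity of the radius is a premise below the existential, so that [choice] gives a function on
   all triples. *)
have step (p : nat * (X * R)) : exists q : X * R, 0 < p.2.2 -> exists i,
  [/\ 0 < q.2, q.2 <= p.2.2 / 2, q.2 <= p.1.+1%:R^-1,
      rnorm (q.1 - p.2.1) <= p.2.2 / 2 &
      forall y, rnorm (y - q.1) <= q.2 -> p.1%:R <= rnorm (T i y)].
  case: p => n [x r] /=; have [r0|r0] := ltP 0 r; last by exists (x, r).
  have [x' [r' [i h]]] := bumping n x unb r0.
  by exists (x', r') => _; exists i.
have [g hg] := choice step.
pose fix a n := if n is m.+1 then g (m, a m) else (0 : X, 1 : R).
have a0 n : 0 < (a n).2.
  by elim: n => [//|n /(hg (n, a n))[i []]].
have aS n := hg (n, a n) (a0 n).
have ball1 n y : rnorm (y - (a n.+1).1) <= (a n.+1).2 ->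
    rnorm (y - (a n).1) <= (a n).2.
  move=> yn; have [i [_ /= h1 _ h2 _]] := aS n.
  apply: le_trans (rdistD (a n.+1).1 _ _) _.
  by move: yn h1 h2; rewrite /=; lra.
have ball n k y : rnorm (y - (a (n + k)%N).1) <= (a (n + k)%N).2 ->
    rnorm (y - (a n).1) <= (a n).2.
  by elim: k => [|k IH]; rewrite ?addn0// addnS => /ball1/IH.
have ballc n k : rnorm ((a (n + k)%N).1 - (a n).1) <= (a n).2.
  by apply: (@ball n k); rewrite subrr rnorm0 ltW.
have /cvg_ex[l al] : cvg ((a n).1 @[n --> \oo]).
  apply: cauchy_rnorm => e e0; have [N hN] := exists_invS_le e0.
  exists N.+1 => n /subnK <-; rewrite addnC rdistC.
  apply: le_trans (ballc _ _) _; apply: le_trans hN.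
  by have [i [_ _ h _ _]] := aS N.
have lball n : rnorm (l - (a n).1) <= (a n).2.
  apply/ler_addgt0Pr => e e0.
  have /cvg_rnormP/(_ _ e0)[N _ hN] := al.
  have := hN (n + N)%N (leq_addl _ _) => /= h.
  apply: le_trans (rdistD (a (n + N)%N).1 _ _) _.
  by rewrite addrC lerD.
have [M hM] := pw l.
have [i [_ _ _ _ h]] := aS (Num.truncn M).+1.
have := le_trans (h l (lball (Num.truncn M).+2)) (hM i).
by rewrite leNgt (lt_le_trans (truncnS_gt _))// ler_nat.
Qed.

End UniformBoundedness.

(** * Borel sets *)

Section Borel.
Variable R : realType.
Implicit Types (d e : set R[i]) (F : R[i] -> R[i]).

Lemma borel_set0 : borel_set (set0 : set R[i]).
Proof. exact: measurable0. Qed.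

Lemma borel_setT : borel_set (setT : set R[i]).
Proof. exact: (@measurableT _ (borelC R)). Qed.

Lemma borel_setC d : borel_set d -> borel_set (~` d).
Proof. exact: (@measurableC _ (borelC R)). Qed.

Lemma borel_setU d e : borel_set d -> borel_set e -> borel_set (d `|` e).
Proof. exact: (@measurableU _ (borelC R)). Qed.

Lemma borel_setI d e : borel_set d -> borel_set e -> borel_set (d `&` e).
Proof. exact: (@measurableI _ (borelC R)). Qed.

Lemma borel_setD d e : borel_set d -> borel_set e -> borel_set (d `\` e).
Proof. exact: (@measurableD _ (borelC R)). Qed.

Lemma borel_bigcup (d : nat -> set R[i]) :
  (forall n, borel_set (d n)) -> borel_set (\bigcup_n d n).
Proof. exact: (@bigcupT_measurable _ (borelC R)). Qed.

Lemma borel_seqDU (d : nat -> set R[i]) :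
  (forall n, borel_set (d n)) -> forall n, borel_set (seqDU d n).
Proof. exact: (@seqDU_measurable _ (borelC R)). Qed.

Lemma open_borel d :
  (forall z, d z -> exists2 r : R, 0 < r & forall w, rnorm (z - w) < r -> d w) ->
  borel_set d.
Proof.
move=> h; apply: sub_sigma_algebra.
exact: (iffRL (@open_rnormP R (R[i])^o d)).
Qed.

Lemma borel_fun_open F :
  (forall d : set (R[i])^o, open d -> borel_set (F @^-1` d)) -> borel_fun F.
Proof.
move=> h; apply: (@measurability _ _ (borelC R) (borelC R) setT F (@open (R[i])^o)) => //.
by move=> _ [d od <-]; rewrite setTI; exact: h.
Qed.

Lemma borel_fun_preimage F d : borel_fun F -> borel_set d -> borel_set (F @^-1` d).
Proof. by move=> bF bd; have := bF measurableT d bd; rewrite setTI. Qed.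

Lemma borel_fun_id : borel_fun (id : R[i] -> R[i]).
Proof. by move=> _ Y mY; rewrite setTI. Qed.

Lemma borel_set1 (z : R[i]) : borel_set [set z].
Proof.
rewrite -[X in borel_set X]setCK; apply: borel_setC; apply: open_borel => w /= wz.
exists (rnorm (w - z)).
  rewrite lt_neqAle rnorm_ge0 andbT eq_sym rnorm_eq0 subr_eq0.
  exact/eqP.
by move=> v vw vz; move: vw; rewrite vz ltxx.
Qed.

Lemma borel_Re_lt (a : R) : borel_set [set z : R[i] | complex.Re z < a].
Proof.
apply: open_borel => z /= za; exists (a - complex.Re z); first by rewrite subr_gt0.
move=> w zw; have := le_lt_trans (Re_le_rnorm _) zw.
rewrite raddfB /= distrC => /(le_lt_trans (ler_norm _)).
by rewrite ltrD2r.
Qed.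

Lemma borel_Im_lt (a : R) : borel_set [set z : R[i] | complex.Im z < a].
Proof.
apply: open_borel => z /= za; exists (a - complex.Im z); first by rewrite subr_gt0.
move=> w zw; have := le_lt_trans (Im_le_rnorm _) zw.
rewrite raddfB /= distrC => /(le_lt_trans (ler_norm _)).
by rewrite ltrD2r.
Qed.

Lemma borel_ball (z : R[i]) (r : R) : borel_set [set w : R[i] | rnorm (w - z) < r].
Proof.
apply: open_borel => w /= wr; exists (r - rnorm (w - z)); first by rewrite subr_gt0.
move=> v wv; apply: le_lt_trans (rdistD w _ _) _.
by rewrite -ltrBrDr rdistC.
Qed.

Lemma borel_cball (z : R[i]) (r : R) : borel_set [set w : R[i] | rnorm (w - z) <= r].
Proof.
rewrite -[X in borel_set X]setCK; apply: borel_setC; apply: open_borel => w /= wr.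
have {}wr : r < rnorm (w - z) by rewrite ltNge; exact/negP.
exists (rnorm (w - z) - r); first by rewrite subr_gt0.
move=> v wv /= vz; have := rdistD v w z.
by move: wv vz; lra.
Qed.

Lemma borel_fun_indicM F d : borel_fun F -> borel_set d ->
  borel_fun (fun z => F z * \1_d z).
Proof.
move=> bF bd; apply: borel_fun_open => U oU.
rewrite [X in borel_set X](_ : _ =
  (d `&` F @^-1` U) `|` (~` d `&` [set z | U 0])).
  have bU : borel_set U by exact: sub_sigma_algebra.
  apply: borel_setU; apply: borel_setI => //.
  - exact: borel_fun_preimage.
  - exact: borel_setC.
  - have [u|u] := pselect (U 0); first by rewrite (_ : mkset _ = setT)
      ?predeqE//; exact: borel_setT.
    by rewrite (_ : mkset _ = set0) ?predeqE//; exact: borel_set0.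
apply/seteqP; split=> z /=; rewrite indicE.
  by have [|] := boolP (z \in d) => h; rewrite ?mulr1 ?mulr0;
    move: h; rewrite ?inE ?notin_setE => h u; [left|right].
by move=> [[dz Fz]|[dz Fz]]; [rewrite mem_set// mulr1|rewrite memNset// mulr0].
Qed.

(** On the open set V preimages of open sets are open; off V the function is 0, so the rest of the
    preimage is all of ~V or empty. Taking for V the complement of a point admits functions with a
    pole there. *)
Lemma borel_fun_continuous_on F (V : set R[i]) :
  (forall z, V z -> exists2 r : R, 0 < r & forall w, rnorm (z - w) < r -> V w) ->
  (forall z (e : R), V z -> 0 < e -> exists2 r : R, 0 < r &
    forall w, rnorm (z - w) < r -> rnorm (F z - F w) < e) ->
  borel_fun (fun z => F z * \1_V z).
Proof.
move=> oV cF; have bV : borel_set V by exact: open_borel.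
apply: borel_fun_open => U oU.
rewrite [X in borel_set X](_ : _ =
  (V `&` F @^-1` U) `|` (~` V `&` [set z | U 0])).
  apply: borel_setU.
    apply: open_borel => z [Vz Uz].
    have [r1 r10 h1] := oV _ Vz.
    have [e e0 he] := (open_rnormP U).1 oU _ Uz.
    have [r2 r20 h2] := cF _ _ Vz e0.
    exists (Num.min r1 r2); first by rewrite lt_min r10.
    by move=> w; rewrite lt_min => /andP[w1 w2]; split; [exact: h1|exact/he/h2].
  apply: borel_setI; first exact: borel_setC.
  have [u|u] := pselect (U 0); first by rewrite (_ : mkset _ = setT)
    ?predeqE//; exact: borel_setT.
  by rewrite (_ : mkset _ = set0) ?predeqE//; exact: borel_set0.
apply/seteqP; split=> z /=; rewrite indicE.
  by have [|] := boolP (z \in V) => h; rewrite ?mulr1 ?mulr0;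
    move: h; rewrite ?inE ?notin_setE => h u; [left|right].
by move=> [[dz Fz]|[dz Fz]]; [rewrite mem_set// mulr1|rewrite memNset// mulr0].
Qed.

End Borel.

(* Takes finitely many values, each on a Borel set; the values may lie in any
   choice type, so that two such functions can be paired. *)
Definition finite_borel (R : realType) (K : choiceType) (p : R[i] -> K) : Prop :=
  (exists r : seq K, forall z, p z \in r) /\ forall S, borel_set (p @^-1` S).

Section FiniteBorel.
Variable R : realType.

(** The preimage of any S is the union of finitely many level sets, written as a countable union
    padded with [set0]. *)
Lemma finite_borel1 (K : choiceType) (p : R[i] -> K) (r : seq K) :
  (forall z, p z \in r) -> (forall k, borel_set (p @^-1` [set k])) ->
  finite_borel p.
Proof.
move=> pr bp; split; first by exists r.
move=> S; rewrite [X in borel_set X](_ : _ =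
    \bigcup_n (if (n < size r)%N then
       [set z | nth (p 0) r n = p z /\ S (p z)] else set0)).
  apply: borel_bigcup => n; case: ifP => // _; last exact: borel_set0.
  have [Sn|Sn] := pselect (S (nth (p 0) r n)).
    rewrite (_ : mkset _ = p @^-1` [set nth (p 0) r n]) //.
    by apply/seteqP; split=> z /=; [case=> -> _|move=> ->].
  rewrite (_ : mkset _ = set0); first exact: borel_set0.
  by apply/seteqP; split=> z //= [<-].
apply/seteqP; split=> z /=.
  move=> Sz; exists (index (p z) r) => //.
  by rewrite index_mem pr /= nth_index.
by move=> [n _]; case: ifP => // _ [_].
Qed.

Lemma finite_borel_comp (K L : choiceType) (g : K -> L) (p : R[i] -> K) :
  finite_borel p -> finite_borel (g \o p).
Proof.
move=> [[r pr] bp]; split; first by exists (map g r) => z; apply: map_f.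
by move=> S; exact: (bp (g @^-1` S)).
Qed.

Lemma finite_borel_pair (K L : choiceType) (p : R[i] -> K) (q : R[i] -> L) :
  finite_borel p -> finite_borel q -> finite_borel (fun z => (p z, q z)).
Proof.
move=> [[r pr] bp] [[s qs] bq]; apply: (@finite_borel1 _ _ [seq (k, l) | k <- r, l <- s]).
  by move=> z; apply: allpairs_f.
move=> [k l]; rewrite [X in borel_set X](_ : _ = p @^-1` [set k] `&` q @^-1` [set l]).
  exact: borel_setI.
by apply/seteqP; split=> z /= [-> ->].
Qed.

Lemma finite_borel_indic (d : set R[i]) :
  borel_set d -> finite_borel (fun z => z \in d).
Proof.
move=> bd; apply: (@finite_borel1 _ _ [:: true; false]).
  by move=> z; case: (_ \in _).
case.
  by rewrite (_ : _ @^-1` _ = d)//; apply/seteqP; split=> z /=; [exact: set_mem|exact: mem_set].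
rewrite (_ : _ @^-1` _ = ~` d); first exact: borel_setC.
apply/seteqP; split=> z /=; last exact: memNset.
by move/negbT; rewrite notin_setE.
Qed.

Lemma simple_funP (s : R[i] -> R[i]) : simple_fun s <-> finite_borel s.
Proof.
split=> [[bs fs]|[[r sr] bs]]; last first.
  split; first by move=> _ Y _; rewrite setTI; exact: bs.
  apply: (@sub_finite_set _ _ [set` r]); last exact: finite_seq.
  by move=> _ [z _ <-] /=; apply: sr.
have [r rE] := (finite_seqP _).1 fs.
apply: (@finite_borel1 _ _ r).
  by move=> z; have : range s (s z) by []; rewrite rE.
by move=> k; apply: borel_fun_preimage => //; exact: borel_set1.
Qed.

End FiniteBorel.

(** * Spectral measures *)

Section SpectralMeasure.
Variables (R : realType) (X : completeNormedModType R[i]).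
Variable E : set R[i] -> X -> X.
Hypothesis hE : spectral_measure E.
Implicit Types (d e : set R[i]) (f : X).

Lemma spectral_linear d : borel_set d -> linear (E d).
Proof. by move=> bd; case: (spectral_measure_bounded hE bd). Qed.

Lemma spectral_add d e f : borel_set d -> borel_set e -> d `&` e = set0 ->
  E (d `|` e) f = E d f + E e f.
Proof.
move=> bd be de.
pose u n := if n is m.+1 then (if m is _.+1 then set0 else e) else d.
have bu n : borel_set (u n).
  by case: n => [|[|n]] //=; exact: borel_set0.
have tu : trivIset setT u.
  apply/trivIsetP => -[|[|i]] [|[|j]] //= _ _ _; rewrite ?setI0 ?set0I//.
  by rewrite setIC.
have := @spectral_measure_sigma_additive _ _ _ hE u bu tu f.
have -> : \bigcup_n u n = d `|` e.
  apply/seteqP; split=> z /=.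
    by case=> -[|[|n]] _ //=; [left|right].
  by case=> h; [exists 0%N|exists 1%N].
move/cvg_lim => <- //; apply: lim_near_cst => //.
exists 2%N => // -[|[|n]] //= _.
rewrite 2!big_ord_recl big1 ?addr0// => k _; exact: spectral_measure0.
Qed.

Lemma spectralC d f : borel_set d -> E (~` d) f = f - E d f.
Proof.
move=> bd; have := spectral_add f bd (borel_setC bd) (setICr d).
by rewrite setUCr spectral_measureT// => h; rewrite [X in X - _]h addrC addKr.
Qed.

(** Countable additivity on the disjoint differences [seqD d], whose partial sums telescope to E (d
    n) f. *)
Lemma spectral_cvg (d : nat -> set R[i]) f : (forall n, borel_set (d n)) ->
  nondecreasing_seq d -> E (d n) f @[n --> \oo] --> E (\bigcup_n d n) f.
Proof.
move=> bd nd; have bs n : borel_set (seqD d n).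
  by rewrite -seqDU_seqD//; exact: borel_seqDU.
have := @spectral_measure_sigma_additive _ _ _ hE _ bs (trivIset_seqD nd) f.
rewrite eq_bigcup_seqD -cvg_shiftS /=.
apply: cvg_trans; apply: near_eq_cvg; near=> n.
elim: (n) => [|m IH]; first by rewrite big_ord_recl big_ord0 addr0.
have -> : d m.+1 = d m `|` seqD d m.+1 by exact: setU_seqD.
rewrite big_ord_recr [LHS]/= IH spectral_add//.
by apply/seteqP; split=> // z /= [? [_]].
Unshelve. all: by end_near. Qed.

Lemma spectral_null d e : borel_set d -> borel_set e -> d `<=` e ->
  (forall f, E e f = 0) -> forall f, E d f = 0.
Proof.
move=> bd be /setIidPl de e0 f.
by rewrite -de spectral_measureI// e0 (linear_fun0 (spectral_linear bd)).
Qed.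

Lemma spectral_null_bigcup (d : nat -> set R[i]) : (forall n, borel_set (d n)) ->
  (forall n f, E (d n) f = 0) -> forall f, E (\bigcup_n d n) f = 0.
Proof.
move=> bd d0 f; rewrite seqDU_bigcup_eq.
have := @spectral_measure_sigma_additive _ _ _ hE _ (borel_seqDU bd) (@trivIset_seqDU _ d) f.
move/cvg_lim => <- //; apply: lim_near_cst => //.
near=> n; rewrite big1// => k _.
apply: (spectral_null _ (bd k) _ (d0 k)); first exact: borel_seqDU.
exact: subset_seqDU.
Unshelve. all: by end_near. Qed.

(* Otherwise halving gives a decreasing sequence of Borel sets d n with
   |E (d n) f| >= n, although E (d n) f converges. *)
Lemma spectral_pointwise_bounded f :
  exists M : R, forall d, borel_set d -> rnorm (E d f) <= M.
Proof.
apply: contrapT => unb.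
pose big d := borel_set d /\
  forall M : R, exists e, [/\ borel_set e, e `<=` d & M < rnorm (E e f)].
have bigT : big setT.
  split; first exact: borel_setT.
  move=> M; apply: contrapT => h; apply: unb; exists M => d bd.
  by rewrite leNgt; apply/negP => Md; apply: h; exists d.
have step (p : nat * set R[i]) : exists e, big p.2 ->
    [/\ big e, e `<=` p.2 & p.1%:R <= rnorm (E e f)].
  case: p => n d /=; have [bigd|?] := pselect (big d); last by exists d.
  have [bd ud] := bigd.
  (* The margin |E d f| forces E (d \ e) f to have norm at least n as well, so either half may be
     kept. *)
  have [e [be ed Me]] := ud (n%:R + rnorm (E d f)).
  have ne : n%:R <= rnorm (E e f).
    by apply: le_trans (ltW Me); rewrite lerDl rnorm_ge0.
  have bde : borel_set (d `\` e) by exact: borel_setD.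
  have dE : E d f = E e f + E (d `\` e) f.
    rewrite -spectral_add//; first by rewrite setDUK.
    by apply/seteqP; split=> // z /= [? [_]].
  have nde : n%:R <= rnorm (E (d `\` e) f).
    have := ler_rnorm_sub (E e f) (E d f).
    rewrite rdistC {2}dE addrAC subrr add0r.
    by move: Me; lra.
  (* One half is big again: bounds over the subsets of e and over those of d \ e would add up to a
     bound over the subsets of d. *)
  have [h1|h1] := pselect (big e); first by exists e.
  exists (d `\` e) => _; split=> //; split=> // M.
  apply: contrapT => h; apply: h1; split=> // M'.
  have [c [bc cd Mc]] := ud (M + M').
  exists (c `&` e); split; [exact: borel_setI|by move=> z []|].
  have cE : E c f = E (c `&` e) f + E (c `\` e) f.
    rewrite -spectral_add//; [by rewrite setUIDK|exact: borel_setI|exact: borel_setD|].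
    by apply/seteqP; split=> // z /= [[? ?] [_]].
  have h2 : rnorm (E (c `\` e) f) <= M.
    rewrite leNgt; apply/negP => h2; apply: h.
    exists (c `\` e); split=> //; first exact: borel_setD.
    by move=> z [cz ez]; split=> //; exact: cd.
  have := ler_rnormD (E (c `&` e) f) (E (c `\` e) f).
  by rewrite -cE; move: h2 Mc; lra.
have [g hg] := choice step.
pose fix a n := if n is m.+1 then g (m, a m) else setT.
have biga n : big (a n) by elim: n => [//|n /(hg (n, a n))[]].
have aS n : a n.+1 `<=` a n by have [_ ? _] := hg (n, a n) (biga n).
have an n : n%:R <= rnorm (E (a n.+1) f).
  by have [_ _ ?] := hg (n, a n) (biga n).
have ba n : borel_set (a n) by case: (biga n).
(* [spectral_cvg] is about increasing sequences, hence the passage to complements, where E takes the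
   value f - E (a n) f. *)
have bCa n : borel_set (~` a n) by exact: borel_setC.
have nd : nondecreasing_seq (fun n => ~` a n).
  by apply/nondecreasing_seqP => n; rewrite subsetEset; exact: subsetC.
have /cvg_rnormP/(_ 1 ltr01)[N _ hN] := @spectral_cvg _ f bCa nd.
set v := E _ f in hN.
(* Past N, |E (a m.+1) f| is at most 1 + |v| + |f|; this m exceeds that number, against |E (a m.+1)
   f| >= m. *)
pose m := ((Num.truncn (1 + rnorm v + rnorm f)).+1 + N)%N.
have h : rnorm (v - E (~` a m.+1) f) <= 1.
  exact: hN m.+1 (leq_trans (leq_addl _ _) (leqnSn _)).
rewrite (spectralC f (ba m.+1)) opprB addrCA in h.
have h1 := an m.
have h2 : 1 + rnorm v + rnorm f < m%:R.
  by apply: lt_le_trans (truncnS_gt _) _; rewrite ler_nat leq_addr.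
have h3 := ler_rnorm_sub (E (a m.+1) f) (- (v - f)).
have h4 := ler_rnormB v f.
rewrite opprK rnormN in h3.
by move: h h1 h2 h3 h4; lra.
Qed.

Lemma spectral_uniformly_bounded : exists2 M : R, 0 <= M &
  forall d f, borel_set d -> rnorm (E d f) <= M * rnorm f.
Proof.
have [|M M0 h] := @uniform_boundedness R X {d | borel_set d}
    (fun i => E (proj1_sig i))
    (fun i => spectral_measure_bounded hE (proj2_sig i)).
  move=> f; have [M hM] := spectral_pointwise_bounded f.
  by exists M => -[d bd]; exact: hM.
by exists M => // d f bd; exact: (h (exist (@borel_set R) d bd) f).
Qed.

End SpectralMeasure.

(** * Integrals of simple functions *)

Section SimpleIntegral.
Variables (R : realType) (X : completeNormedModType R[i]).
Variable E : set R[i] -> X -> X.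
Hypothesis hE : spectral_measure E.
Implicit Types (d e : set R[i]) (f : X) (s t : R[i] -> R[i]).

Lemma spectral_partition (K : choiceType) (p : R[i] -> K) (r : seq K) d f :
  finite_borel p -> uniq r -> borel_set d ->
  E (d `&` p @^-1` [set` r]) f = \sum_(k <- r) E (d `&` p @^-1` [set k]) f.
Proof.
move=> [_ bp] + bd; elim: r => [_|k r IH /= /andP[kr ur]].
  rewrite big_nil (_ : _ `&` _ = set0) ?(spectral_measure0 hE)//.
  by apply/seteqP; split=> z // [_].
rewrite big_cons -IH// -(spectral_add hE); first last.
- apply/seteqP; split=> z //= [[_ pzk] [_ pzr]].
  by move: kr; rewrite -pzk pzr.
- by apply: borel_setI.
- by apply: borel_setI.
congr (E _ f); apply/seteqP; split=> z /=.
  by rewrite inE => -[dz /orP[/eqP|]]; [left|right].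
by rewrite inE => -[[dz ->]|[dz ->]]; rewrite ?eqxx ?orbT.
Qed.

(** The integral may be computed on the partition of any finer p instead of the level sets of g \o
    p. With p the pair of two simple functions, sums and products become termwise. Each k
    contributes only to the value c = g k after the two sums are exchanged. *)
Lemma simple_integralE (K : choiceType) (p : R[i] -> K) (g : K -> R[i])
    (r : seq K) f : finite_borel p -> uniq r -> (forall z, p z \in r) ->
  simple_integral E (g \o p) f = \sum_(k <- r) g k *: E (p @^-1` [set k]) f.
Proof.
move=> fp ur pr; have [_ bp] := fp.
have [_ bs] := finite_borel_comp g fp.
pose r' := undup (map g r).
rewrite /simple_integral (@fsbig_fwiden _ _ _ _ r'); first last.
- move=> c [_ cr] /=; rewrite (_ : _ @^-1` _ = set0).
    by rewrite (spectral_measure0 hE) scaler0.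
  by apply/seteqP; split=> z //= gz; apply: cr; exists z.
- exact: undup_uniq.
- by move=> _ [z _ <-] /=; rewrite mem_undup map_f.
under eq_bigr => c _.
  rewrite -[_ @^-1` _](setIT) (_ : setT = p @^-1` [set` r]); last first.
    by apply/seteqP; split=> z //= _; exact: pr.
  rewrite spectral_partition//.
  rewrite scaler_sumr; over.
rewrite exchange_big; apply: eq_big_seq => k kr /=.
rewrite (bigD1_seq (g k)) ?undup_uniq ?mem_undup ?map_f//= big1 ?addr0.
  congr (_ *: E _ f); apply/seteqP; split=> z /=; first by case.
  by move=> ->.
move=> c cg; rewrite (_ : _ `&` _ = set0).
  by rewrite (spectral_measure0 hE) scaler0.
by apply/seteqP; split=> z //= [gz pzk]; move: cg; rewrite -gz pzk eqxx.
Qed.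

Lemma simple_integral_linear s : finite_borel s -> linear (simple_integral E s).
Proof.
move=> fs; have [[r sr] bs] := fs; move=> a f g.
rewrite !(@simple_integralE _ s id (undup r)) ?undup_uniq//;
  try by move=> z; rewrite mem_undup.
rewrite scaler_sumr -big_split /=; apply: eq_bigr => k _.
by rewrite (spectral_linear hE (bs _)) scalerDr !scalerA mulrC.
Qed.

Lemma simple_integral_indic d f : borel_set d -> simple_integral E \1_d f = E d f.
Proof.
move=> bd.
have -> : \1_d = (fun b : bool => b%:R : R[i]) \o (fun z => z \in d).
  by apply/funext => z /=; rewrite indicE.
rewrite (@simple_integralE _ _ _ [:: true; false])//; first last.
- by move=> z; case: (_ \in _).
- exact: finite_borel_indic.
rewrite !big_cons big_nil scale1r scale0r !addr0.
by congr (E _ f); apply/seteqP; split=> z /=; [exact: set_mem|exact: mem_set].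
Qed.

Lemma simple_integralZ (a : R[i]) s f : finite_borel s ->
  simple_integral E (fun z => a * s z) f = a *: simple_integral E s f.
Proof.
move=> fs; have [[r sr] bs] := fs.
have sr' z : s z \in undup r by rewrite mem_undup.
rewrite (@simple_integralE _ s ( *%R a) (undup r)) ?undup_uniq//.
rewrite (@simple_integralE _ s id (undup r)) ?undup_uniq// scaler_sumr.
by apply: eq_bigr => k _; rewrite scalerA.
Qed.

Section Pair.
Variables (s t : R[i] -> R[i]) (rs rt : seq R[i]).
Hypotheses (fs : finite_borel s) (ft : finite_borel t).
Hypotheses (srs : forall z, s z \in rs) (trt : forall z, t z \in rt).

Let r := undup [seq (a, b) | a <- rs, b <- rt].

Let integral_pair (h : R[i] * R[i] -> R[i]) f :
  simple_integral E (fun z => h (s z, t z)) f =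
  \sum_(k <- r) h k *: E ((fun z => (s z, t z)) @^-1` [set k]) f.
Proof.
apply: (@simple_integralE _ (fun z => (s z, t z)) h) => //.
- exact: finite_borel_pair.
- exact: undup_uniq.
- by move=> z; rewrite mem_undup; exact: allpairs_f.
Qed.

Lemma simple_integralD_subproof f :
  simple_integral E (fun z => s z + t z) f =
  simple_integral E s f + simple_integral E t f.
Proof.
rewrite (integral_pair (fun k => k.1 + k.2)).
rewrite (integral_pair fst) (integral_pair snd) -big_split /=.
by apply: eq_bigr => k _; rewrite scalerDl.
Qed.

(** On the common partition the cross terms vanish, E of two distinct cells composing to E of the
    empty set, and each projection is idempotent. *)
Lemma simple_integralM_subproof f :
  simple_integral E (fun z => s z * t z) f =
  simple_integral E s (simple_integral E t f).
Proof.
have [_ bs] := fs; have [_ bt] := ft.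
have ls := simple_integral_linear fs.
have fst1 k : borel_set ((fun z => (s z, t z)) @^-1` [set k]).
  by have [_ h] := finite_borel_pair fs ft; exact: h.
rewrite (integral_pair (fun k => k.1 * k.2)) (integral_pair snd).
rewrite (linear_fun_sum _ _ ls); apply: eq_bigr => k _.
rewrite (linear_funZ _ _ ls) (integral_pair fst).
rewrite mulrC -scalerA; congr (_ *: _).
have fE := spectral_measureI hE.
have [kr|kr] := boolP (k \in r); last first.
  rewrite (_ : _ @^-1` [set k] = set0) ?(spectral_measure0 hE) ?scaler0.
    rewrite big1// => l _.
    by rewrite (linear_fun0 (spectral_linear hE (fst1 l))) scaler0.
  apply/seteqP; split=> z //= zk; move: kr.
  by rewrite -zk mem_undup allpairs_f.
rewrite (bigD1_seq k) ?undup_uniq//= big1 ?addr0.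
  by rewrite (spectral_measure_proj hE).
move=> l lk; rewrite -fE// (_ : _ `&` _ = set0) ?(spectral_measure0 hE) ?scaler0//.
by apply/seteqP; split=> z //= [zl zk]; move: lk; rewrite -zl zk eqxx.
Qed.

End Pair.

Lemma simple_integralD s t f : finite_borel s -> finite_borel t ->
  simple_integral E (fun z => s z + t z) f =
  simple_integral E s f + simple_integral E t f.
Proof.
move=> fs ft; have [[rs srs] _] := fs; have [[rt trt] _] := ft.
exact: simple_integralD_subproof srs trt f.
Qed.

Lemma simple_integralM s t f : finite_borel s -> finite_borel t ->
  simple_integral E (fun z => s z * t z) f =
  simple_integral E s (simple_integral E t f).
Proof.
move=> fs ft; have [[rs srs] _] := fs; have [[rt trt] _] := ft.
exact: simple_integralM_subproof srs trt f.
Qed.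

Lemma simple_integralB s t f : finite_borel s -> finite_borel t ->
  simple_integral E (fun z => s z - t z) f =
  simple_integral E s f - simple_integral E t f.
Proof.
move=> fs ft; rewrite -scaleN1r -simple_integralZ// -simple_integralD//.
  by congr (simple_integral E _ f); apply/funext => z; rewrite mulN1r.
exact: (finite_borel_comp ( *%R (-1)) ft).
Qed.

(* The norm is convex in each coefficient, so it is maximal at a vertex of the
   cube, where the sum is the value of E at one set. *)
Lemma simple_sum_cube (K : choiceType) (p : R[i] -> K) (r : seq K) (S : set K)
    (c : K -> R) (b m : R) f :
  finite_borel p -> uniq r -> (forall k, k \in r -> ~ S k) ->
  (forall d, borel_set d -> rnorm (E d f) <= m) ->
  (forall k, k \in r -> 0 <= c k <= b) -> 0 <= b ->
  rnorm (\sum_(k <- r) toC (c k) *: E (p @^-1` [set k]) f +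
         toC b *: E (p @^-1` S) f) <= b * m.
Proof.
move=> fp + + hm + b0; have [_ bp] := fp.
elim: r S => [|k r IH] S.
  move=> _ _ _; rewrite big_nil add0r rnormZ rnorm_toC ger0_norm//.
  by rewrite ler_wpM2l// hm.
move=> /= /andP[kr ur] Sr cb; rewrite big_cons.
have h1 : rnorm (\sum_(k <- r) toC (c k) *: E (p @^-1` [set k]) f +
                 toC b *: E (p @^-1` S) f) <= b * m.
  by apply: IH => // j jr; [apply: Sr|apply: cb]; rewrite inE jr orbT.
have h2 : rnorm (\sum_(k <- r) toC (c k) *: E (p @^-1` [set k]) f +
                 toC b *: E (p @^-1` (S `|` [set k])) f) <= b * m.
  apply: IH => // j jr; last by apply: cb; rewrite inE jr orbT.
  move=> [Sj|jk]; first by apply: (Sr j) => //; rewrite inE jr orbT.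
  by move: kr; rewrite -jk jr.
move: h1 h2; rewrite preimage_setU (spectral_add hE) ?bp//; last first.
  apply/seteqP; split=> z //= [Sz zk]; apply: (Sr (p z)) => //.
  by rewrite zk mem_head.
set w := \sum_(_ <- _) _; set u := E _ f; set v := E _ f => h1 h2.
have /andP[c0 cb'] := cb k (mem_head _ _).
(* The coefficient c k = h b lies between 0, where the induction hypothesis is used with S, and b,
   where k is added to S. If b = 0, then c k = 0 and the quotient is 0 too. *)
pose h := c k / b.
have hc : c k = h * b.
  rewrite /h; have [b00|bn0] := eqVneq b 0; last by rewrite divfK.
  by move: c0 cb'; rewrite b00 mulr0; lra.
have h0 : 0 <= h by rewrite divr_ge0.
have h1' : h <= 1.
  rewrite /h; have [->|bn0] := eqVneq b 0; first by rewrite invr0 mulr0.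
  by rewrite ler_pdivrMr ?mul1r// lt_neqAle eq_sym bn0.
have -> : toC (c k) *: v + w + toC b *: u =
    toC h *: (w + toC b *: (u + v)) + toC (1 - h) *: (w + toC b *: u).
  rewrite hc rmorphM rmorphB rmorph1 /= scalerBl scale1r addrCA -scalerBr.
  rewrite [toC b *: (u + v)]scalerDr addrA [w + _ + _ - _]addrC addKr.
  by rewrite scalerA [RHS]addrC addrA.
apply: le_trans (ler_rnormD _ _) _; rewrite !rnormZ !rnorm_toC !ger0_norm ?subr_ge0//.
have := ler_wpM2l h0 h2.
have h1'' : 0 <= 1 - h by rewrite subr_ge0.
have := ler_wpM2l h1'' h1.
by lra.
Qed.

(** The factor 4 counts the positive and negative parts of the real and imaginary parts of the
    coefficients; [simple_sum_cube] with S empty bounds each of the four sums. *)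
Lemma simple_sum_bound (r : seq R[i]) s (b m : R) f :
  finite_borel s -> uniq r ->
  (forall d, borel_set d -> rnorm (E d f) <= m) -> 0 <= b ->
  (forall k, k \in r -> rnorm k <= b) ->
  rnorm (\sum_(k <- r) k *: E (s @^-1` [set k]) f) <= 4 * (b * m).
Proof.
move=> fs ur hm b0 rb.
have pos (c : R[i] -> R) : (forall k, k \in r -> 0 <= c k <= b) ->
    rnorm (\sum_(k <- r) toC (c k) *: E (s @^-1` [set k]) f) <= b * m.
  move=> hc; have := @simple_sum_cube _ s r set0 c b m f fs ur _ hm hc b0.
  by rewrite preimage_set0 (spectral_measure0 hE) scaler0 addr0; apply=> ? _ [].
have real (c : R[i] -> R) : (forall k, k \in r -> `|c k| <= b) ->
    rnorm (\sum_(k <- r) toC (c k) *: E (s @^-1` [set k]) f) <= 2 * (b * m).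
  move=> hc; under eq_bigr => k _.
    rewrite [c k](_ : _ = Num.max (c k) 0 - Num.max (- c k) 0); last first.
      by rewrite /Num.max; case: ltP => ?; case: ltP => ?; lra.
    rewrite rmorphB /= scalerBl; over.
  rewrite sumrB mulr_natl mulr2n; apply: le_trans (ler_rnormB _ _) _.
  apply: lerD; apply: pos => k /hc; rewrite ler_norml le_max lexx orbT /=.
    by rewrite ge_max b0 andbT => /andP[].
  by rewrite ge_max b0 andbT lerNl => /andP[].
rewrite (eq_bigr (fun k => toC (complex.Re k) *: E (s @^-1` [set k]) f +
   'i%C *: (toC (complex.Im k) *: E (s @^-1` [set k]) f))); last first.
  by move=> k _; rewrite scalerA -scalerDl -complexE.
rewrite big_split /= -scaler_sumr.
apply: le_trans (ler_rnormD _ _) _; rewrite rnormZ.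
have -> : rnorm ('i%C : R[i]) = 1.
  by rewrite /rnorm normc_def /= expr0n /= expr1n add0r sqrtr1.
have h1 := real (@complex.Im R); have h2 := real (@complex.Re R).
have : rnorm (\sum_(k <- r) toC (complex.Re k) *: E (s @^-1` [set k]) f) <= 2 * (b * m).
  by apply: h2 => k kr; exact: le_trans (Re_le_rnorm _) (rb _ kr).
have : rnorm (\sum_(k <- r) toC (complex.Im k) *: E (s @^-1` [set k]) f) <= 2 * (b * m).
  by apply: h1 => k kr; exact: le_trans (Im_le_rnorm _) (rb _ kr).
by lra.
Qed.

Lemma simple_integral_bound : exists2 C : R, 0 <= C &
  forall s (b : R) f, finite_borel s -> (forall z, rnorm (s z) <= b) ->
  rnorm (simple_integral E s f) <= C * b * rnorm f.
Proof.
have [M M0 hM] := spectral_uniformly_bounded hE.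
exists (4 * M); first by rewrite mulr_ge0.
move=> s b f fs sb; have [[r sr] _] := fs.
have b0 : 0 <= b by apply: le_trans (sb 0); exact: rnorm_ge0.
(* The list r may contain numbers that s never takes; the filter makes all coefficients obey the
   bound b. *)
pose r' := undup [seq k <- r | rnorm k <= b].
have sr' z : s z \in r' by rewrite mem_undup mem_filter sb sr.
rewrite (@simple_integralE _ s id r') ?undup_uniq//.
rewrite -!mulrA [M * _]mulrCA.
apply: simple_sum_bound => //; first exact: undup_uniq.
- by move=> d; exact: hM.
- by move=> k; rewrite mem_undup mem_filter => /andP[].
Qed.

End SimpleIntegral.

(** * Integrals of bounded functions *)

(* Equivalent to is_bounded_integral, but a single simple function approximates
   F and T at once, which makes the algebraic closure properties direct. *)
Definition is_integral (R : realType) (X : normedModType R[i])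
    (E : set R[i] -> X -> X) (F : R[i] -> R[i]) (T : X -> X) : Prop :=
  bounded_linear T /\
  forall e : R, 0 < e -> exists s : R[i] -> R[i],
    [/\ finite_borel s, forall z, rnorm (s z - F z) <= e &
        forall f, rnorm (simple_integral E s f - T f) <= e * rnorm f].

Section Integral.
Variables (R : realType) (X : completeNormedModType R[i]).
Variable E : set R[i] -> X -> X.
Hypothesis hE : spectral_measure E.
Implicit Types (d : set R[i]) (f : X) (F G s t : R[i] -> R[i]) (S T : X -> X).

Lemma is_integral_simple s : finite_borel s -> is_integral E s (simple_integral E s).
Proof.
move=> fs; split.
  apply/bounded_linearP; split; first exact: simple_integral_linear.
  have [C C0 hC] := simple_integral_bound hE.
  have [[r sr] _] := fs.
  have sb z : rnorm (s z) <= \sum_(k <- r) rnorm k.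
    rewrite (big_rem (s z)) ?sr//= lerDl.
    by apply: sumr_ge0 => k _; exact: rnorm_ge0.
  exists (C * \sum_(k <- r) rnorm k).
    by rewrite mulr_ge0// sumr_ge0// => k _; exact: rnorm_ge0.
  by move=> f; exact: hC.
move=> e e0; exists s; split=> // *; rewrite subrr rnorm0 ?mulr_ge0 ?rnorm_ge0//.
  exact: ltW.
exact: ltW.
Qed.

Lemma is_integral_indic d : borel_set d -> is_integral E \1_d (E d).
Proof.
move=> bd; rewrite (_ : E d = simple_integral E \1_d).
  apply: is_integral_simple.
  exact: (finite_borel_comp (fun b : bool => b%:R : R[i]) (finite_borel_indic bd)).
by apply/funext => f; rewrite simple_integral_indic.
Qed.

Lemma is_integral_linear F T : is_integral E F T -> linear T.
Proof. by move=> [[]]. Qed.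

Lemma is_integral_bounded F T : is_integral E F T ->
  exists2 b : R, 0 <= b & forall z, rnorm (F z) <= b.
Proof.
move=> [_ /(_ 1 ltr01)[s [[[r sr] _] sF _]]].
exists (\sum_(k <- r) rnorm k + 1).
  by rewrite addr_ge0// sumr_ge0// => k _; exact: rnorm_ge0.
move=> z; have := ler_rnorm_sub (F z) (s z); rewrite rdistC => h.
have := sF z; have : rnorm (s z) <= \sum_(k <- r) rnorm k.
  rewrite (big_rem (s z)) ?sr//= lerDl.
  by apply: sumr_ge0 => k _; exact: rnorm_ge0.
by move: h; lra.
Qed.

Lemma is_integral_norm : exists2 C : R, 0 <= C & forall F T (b : R) f,
  is_integral E F T -> (forall z, rnorm (F z) <= b) ->
  rnorm (T f) <= C * b * rnorm f.
Proof.
have [C C0 hC] := simple_integral_bound hE.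
exists C => // F T b f [_ hT] Fb; apply/ler_addgt0Pr => e e0.
have f0 := rnorm_ge0 f.
(* An approximation within d costs C d |f| for the larger bound b + d on s and d |f| for T, in all d
   (C + 1) |f|; the last 1 keeps the denominator positive. *)
have k0 : 0 < (C + 1) * rnorm f + 1.
  by rewrite ltr_wpDl// mulr_ge0// addr_ge0.
have d0 : 0 < e / ((C + 1) * rnorm f + 1) by rewrite divr_gt0.
set d := e / _ in d0.
have de : d * ((C + 1) * rnorm f + 1) = e by rewrite divfK ?gt_eqF.
have [s [fs sF sT]] := hT _ d0.
have sb z : rnorm (s z) <= b + d.
  have := sF z; have := Fb z; have := ler_rnorm_sub (s z) (F z); lra.
have := hC _ _ f fs sb; have := sT f; have := ler_rnorm_sub (T f) (simple_integral E s f).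
rewrite rdistC -de; nra.
Qed.

Lemma is_integralD F G S T : is_integral E F S -> is_integral E G T ->
  is_integral E (fun z => F z + G z) (fun f => S f + T f).
Proof.
move=> [/bounded_linearP[lS [b b0 Sb]] hS] [/bounded_linearP[lT [c c0 Tc]] hT].
split.
  apply/bounded_linearP; split.
    by move=> a f g; rewrite lS lT scalerDr addrACA.
  exists (b + c); first exact: addr_ge0.
  by move=> f; rewrite mulrDl (le_trans (ler_rnormD _ _))// lerD.
move=> e e0; have e20 : 0 < e / 2 by rewrite divr_gt0.
have [s [fs sF sS]] := hS _ e20; have [t [ft tG tT]] := hT _ e20.
exists (fun z => s z + t z); split.
- exact: (finite_borel_comp (fun k => k.1 + k.2) (finite_borel_pair fs ft)).
- move=> z; rewrite opprD addrACA; apply: le_trans (ler_rnormD _ _) _.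
  by rewrite [leRHS](splitr e) lerD.
- move=> f; rewrite simple_integralD// opprD addrACA.
  apply: le_trans (ler_rnormD _ _) _.
  by rewrite [e in leRHS](splitr e) mulrDl lerD.
Qed.

Lemma is_integralZ a F T : is_integral E F T ->
  is_integral E (fun z => a * F z) (fun f => a *: T f).
Proof.
move=> [/bounded_linearP[lT [b b0 Tb]] hT]; split.
  apply/bounded_linearP; split.
    by move=> c f g; rewrite lT scalerDr !scalerA mulrC.
  exists (rnorm a * b); first by rewrite mulr_ge0// rnorm_ge0.
  by move=> f; rewrite rnormZ -mulrA ler_wpM2l// rnorm_ge0.
move=> e e0; have a1 : 0 < rnorm a + 1 by rewrite ltr_wpDl// rnorm_ge0.
have [s [fs sF sT]] := hT _ (divr_gt0 e0 a1).
have ae x : x <= e / (rnorm a + 1) -> rnorm a * x <= e.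
  move=> xe; apply: le_trans (ler_wpM2l (rnorm_ge0 a) xe) _.
  rewrite mulrCA ler_piMr ?(ltW e0)// ler_pdivrMr// mul1r.
  by rewrite lerDl.
exists (fun z => a * s z); split.
- exact: (finite_borel_comp ( *%R a) fs).
- by move=> z; rewrite -mulrBr rnormM; apply: ae.
- move=> f; rewrite simple_integralZ// -scalerBr rnormZ.
  apply: le_trans (ler_wpM2l (rnorm_ge0 a) (sT f)) _.
  rewrite mulrA ler_wpM2r ?rnorm_ge0//; exact: ae.
Qed.

Lemma is_integralB F G S T : is_integral E F S -> is_integral E G T ->
  is_integral E (fun z => F z - G z) (fun f => S f - T f).
Proof.
move=> hS hT; have := is_integralD hS (is_integralZ (-1) hT).
rewrite (_ : (fun z => F z + -1 * G z) = (fun z => F z - G z)).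
  rewrite (_ : (fun f => S f + -1 *: T f) = (fun f => S f - T f))//.
  by apply/funext => f; rewrite scaleN1r.
by apply/funext => f; rewrite mulN1r.
Qed.

Lemma is_integralM F G S T : is_integral E F S -> is_integral E G T ->
  is_integral E (fun z => F z * G z) (fun f => S (T f)).
Proof.
move=> iF iG; have [bF bF0 hbF] := is_integral_bounded iF.
have [bG bG0 hbG] := is_integral_bounded iG.
have [C C0 hC] := simple_integral_bound hE.
move: iF iG => [/bounded_linearP[lS [b b0 Sb]] hS] [/bounded_linearP[lT [c c0 Tc]] hT].
split.
  apply/bounded_linearP; split; first by move=> a f g; rewrite lT lS.
  exists (b * c); first exact: mulr_ge0.
  by move=> f; rewrite -mulrA (le_trans (Sb _))// ler_wpM2l.
move=> e e0.
(* With x <= 1, s is bounded by bF + 1. The error of the functions is at most (bF + 1 + bG) x, that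
   of the operators at most (C (bF + 1) + c) x relative to |f|; k dominates both. *)
pose k := bF + bG + C * (bF + 1) + c + 1.
have k0 : 0 < k by rewrite ltr_wpDl// !addr_ge0// mulr_ge0// addr_ge0.
pose x := Num.min 1 (e / k).
have x0 : 0 < x by rewrite lt_min ltr01 divr_gt0.
have x1 : x <= 1 by rewrite ge_min lexx.
have xk : x * k <= e by rewrite -ler_pdivlMr// ge_min lexx orbT.
have [s [fs sF sS]] := hS _ x0; have [t [ft tG tT]] := hT _ x0.
have sb z : rnorm (s z) <= bF + 1.
  by have := sF z; have := hbF z; have := ler_rnorm_sub (s z) (F z); lra.
have Cb : 0 <= C * (bF + 1) by rewrite mulr_ge0// addr_ge0.
exists (fun z => s z * t z); split.
- exact: (finite_borel_comp (fun k => k.1 * k.2) (finite_borel_pair fs ft)).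
- move=> z; rewrite (_ : _ - _ = s z * (t z - G z) + (s z - F z) * G z); last ring.
  apply: le_trans (ler_rnormD _ _) _; rewrite !rnormM.
  have := sb z; have := tG z; have := sF z; have := hbG z.
  have := rnorm_ge0 (s z); have := rnorm_ge0 (t z - G z).
  have := rnorm_ge0 (s z - F z); have := rnorm_ge0 (G z).
  set u1 := rnorm _; set u2 := rnorm _; set u3 := rnorm _; set u4 := rnorm _.
  move=> p1 p2 p3 p4 q1 q2 q3 q4.
  apply: le_trans (_ : (bF + 1) * x + x * bG <= _).
    by rewrite lerD// ler_pM.
  apply: le_trans xk; rewrite /k.
  by have := mulr_ge0 (ltW x0) Cb; have := mulr_ge0 (ltW x0) c0; lra.
- move=> f; rewrite simple_integralM//.
  have ls := simple_integral_linear hE fs.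
  rewrite (_ : _ - _ = simple_integral E s (simple_integral E t f - T f) +
                       (simple_integral E s (T f) - S (T f))); last first.
    by rewrite (linear_funB _ _ ls) addrA subrK.
  apply: le_trans (ler_rnormD _ _) _.
  have h1 := hC _ _ (simple_integral E t f - T f) fs sb.
  have h2 := sS (T f); have h3 := tT f; have h4 := Tc f.
  have h5 := ler_wpM2l Cb h3.
  have h6 := ler_wpM2l (ltW x0) h4.
  have h7 : 0 <= rnorm f * (x * (bF + bG + 1)).
    by rewrite !mulr_ge0 ?rnorm_ge0 ?(ltW x0) ?addr_ge0.
  have h8 := ler_wpM2r (rnorm_ge0 f) xk.
  by move: h1 h2 h5 h6 h7 h8; rewrite /k; lra.
Qed.

(** S - T is an integral of the zero function, and [is_integral_norm] applies with b = 0. *)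
Lemma is_integral_unique F S T : is_integral E F S -> is_integral E F T -> S = T.
Proof.
move=> hS hT; apply/funext => f; apply/eqP; rewrite -subr_eq0 -rnorm_eq0.
have [C C0 hC] := is_integral_norm.
have := hC _ _ 0 f (is_integralB hS hT).
rewrite mulr0 mul0r eq_le rnorm_ge0 andbT; apply=> z.
by rewrite subrr rnorm0.
Qed.

Lemma is_bounded_integralP F T : is_bounded_integral E F T <-> is_integral E F T.
Proof.
split=> [[bT [s [ss sF sT]]]|[bT hT]]; split=> //.
  move=> e e0; have [lT _] := bT.
  have /fine_cvgP[[N1 _ h1] /cvgrPdist_le/(_ _ e0)[N2 _ h2]] := sT.
  have [N3 _ h3] := sF _ e0.
  pose n := (N1 + N2 + N3)%N.
  have fs := (simple_funP _).1 (ss n).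
  exists (s n); split=> //.
    move=> z; have := h3 n (leq_addl _ _) z.
    by rewrite rnormE ltcR => /ltW.
  apply: le_opnorm.
    move=> a f g; rewrite (simple_integral_linear hE fs) lT.
    by rewrite scalerBr opprD addrACA.
  have N1n : (N1 <= n)%N by rewrite /n -addnA leq_addr.
  have N2n : (N2 <= n)%N by rewrite /n addnAC leq_addl.
  have nfin : opnorm (fun f => simple_integral E (s n) f - T f) \is a fin_num.
    exact: h1 n N1n.
  have := h2 n N2n; rewrite /= sub0r normrN -lee_fin ger0_norm.
    by rewrite fineK.
  by rewrite fine_ge0// opnorm_ge0.
have hn (n : nat) : exists s, [/\ finite_borel s,
    forall z, rnorm (s z - F z) <= n.+1%:R^-1 &
    forall f, rnorm (simple_integral E s f - T f) <= n.+1%:R^-1 * rnorm f].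
  exact: hT.
have {hn} [s hs] := choice hn.
exists s; split.
- by move=> n; apply/simple_funP; have [] := hs n.
- move=> e e0; have [N hN] := exists_invS_le e0; exists N.+1 => // n /= Nn z.
  rewrite rnormE ltcR; have [_ h _] := hs n; apply: le_lt_trans (h z) _.
  apply: lt_le_trans hN; rewrite ltf_pV2 ?posrE ?ltr0n//.
  by rewrite ltr_nat.
- apply: (@squeeze_cvge _ _ _ _ (cst 0%E) _ (EFin \o @harmonic R)).
  + apply: nearW => n; rewrite opnorm_ge0 /=; apply: opnorm_le => //.
    by have [_ _] := hs n.
  + exact: cvg_cst.
  + exact: cvge_harmonic.
Qed.

Lemma bounded_integralE F T : is_integral E F T -> bounded_integral E F = T.
Proof.
move=> hT; apply: xget_unique; first exact/is_bounded_integralP.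
by move=> S /is_bounded_integralP hS; exact: is_integral_unique hS hT.
Qed.

(** Approximants s N and s n with N <= n differ by at most 2 / (N + 1), so [simple_integral_bound]
    makes their integrals Cauchy at a rate proportional to |f|. Passing to the limit keeps this
    rate, which gives both boundedness and the error estimate. *)
Lemma is_integral_exists F :
  (forall e : R, 0 < e -> exists2 s, finite_borel s &
     forall z, rnorm (s z - F z) <= e) -> exists T, is_integral E F T.
Proof.
move=> hF; have [C C0 hC] := simple_integral_bound hE.
have inv0 n : 0 < n.+1%:R^-1 :> R by [].
have /choice[s hs] n : exists s, finite_borel s /\
    forall z, rnorm (s z - F z) <= n.+1%:R^-1.
  by have [s fs sF] := hF _ (inv0 n); exists s.
have fs n : finite_borel (s n) by case: (hs n).
have close N n f : (N <= n)%N ->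
    rnorm (simple_integral E (s N) f - simple_integral E (s n) f) <=
    C * (2 * N.+1%:R^-1) * rnorm f.
  move=> Nn; rewrite -(simple_integralB hE)//; apply: hC.
    exact: (finite_borel_comp (fun k => k.1 - k.2) (finite_borel_pair (fs N) (fs n))).
  move=> z; have [_ h1] := hs N; have [_ h2] := hs n.
  apply: le_trans (rdistD (F z) _ _) _; rewrite mulr_natl mulr2n lerD//.
  rewrite rdistC; apply: le_trans (h2 z) _.
  by rewrite lef_pV2 ?posrE ?ltr0n// ler_nat.
have cv f : cvg (simple_integral E (s n) f @[n --> \oo]).
  apply: cauchy_rnorm => e e0.
  pose k := C * 2 * rnorm f + 1.
  have k0 : 0 < k by rewrite ltr_wpDl// !mulr_ge0// rnorm_ge0.
  have [N hN] := exists_invS_le (divr_gt0 e0 k0).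
  exists N => n Nn; apply: le_trans (close _ _ f Nn) _.
  move: hN; rewrite ler_pdivlMr//; apply: le_trans.
  rewrite /k; move: (inv0 N); set i := _^-1 => i0.
  by rewrite mulrDr mulr1 -subr_ge0 (_ : _ - _ = i) ?ltW//; ring.
pose T f := lim (simple_integral E (s n) f @[n --> \oo]).
have Tlim f : simple_integral E (s n) f @[n --> \oo] --> T f by exact: cv.
have sT N f : rnorm (simple_integral E (s N) f - T f) <=
    C * (2 * N.+1%:R^-1) * rnorm f.
  apply/ler_addgt0Pr => e e0.
  have /cvg_rnormP/(_ _ e0)[M _ hM] := Tlim f.
  apply: le_trans (rdistD (simple_integral E (s (N + M)%N) f) _ _) _.
  apply: lerD; first by apply: close; rewrite leq_addr.
  by rewrite rdistC; apply: hM; exact: leq_addl.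
have lT : linear T.
  move=> a f g; apply: cvg_lim => //.
  rewrite (_ : (fun n => _) = (fun n => a *: simple_integral E (s n) f +
      simple_integral E (s n) g)); last first.
    by apply/funext => n; rewrite (simple_integral_linear hE (fs n)).
  by apply: cvgD => //; apply: cvgZr.
exists T; split.
  apply/bounded_linearP; split=> //.
  have [/bounded_linearP[_ [b b0 hb]] _] := is_integral_simple (fs 0%N).
  exists (b + C * 2); first by rewrite addr_ge0// mulr_ge0.
  move=> f; have := sT 0%N f; have := hb f.
  have := ler_rnorm_sub (T f) (simple_integral E (s 0%N) f).
  by rewrite rdistC invr1; lra.
move=> e e0; have k0 : 0 < C * 2 + 1 by rewrite ltr_wpDl// mulr_ge0.
have [N hN] := exists_invS_le (divr_gt0 e0 k0).
have Ne : N.+1%:R^-1 * (C * 2 + 1) <= e by rewrite -ler_pdivlMr.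
have [_ hsN] := hs N; have sTN := sT N; have i0 := inv0 N.
move: Ne hsN sTN i0; set i : R := _^-1 => Ne hsN sTN i0.
have Ci : 0 <= C * i by rewrite mulr_ge0// ltW.
exists (s N); split=> //.
  by move=> z; apply: le_trans (hsN z) _; lra.
move=> f; apply: le_trans (sTN f) _; rewrite ler_wpM2r ?rnorm_ge0//; lra.
Qed.

(** Real and imaginary parts are rounded down to multiples of h = e / 2. As F is bounded, the
    rounded values lie in a finite grid, indexed by pairs of integers between -N and N. *)
Lemma borel_fun_approx F (b e : R) : borel_fun F -> (forall z, rnorm (F z) <= b) ->
  0 < e -> exists2 s, finite_borel s & forall z, rnorm (s z - F z) <= e.
Proof.
move=> bF Fb e0; pose h := e / 2; have h0 : 0 < h by rewrite divr_gt0.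
pose p z := (Num.floor (complex.Re (F z) / h), Num.floor (complex.Im (F z) / h)).
pose N := (Num.truncn (b / h)).+1.
pose r := [seq Posz i - Posz N | i <- iota 0 (N + N).+1].
have inr (x : R) : `|x| <= b -> Num.floor (x / h) \in r.
  move=> xb; have xN : `|x / h| <= N%:R.
    rewrite normrM [X in _ * X]gtr0_norm ?invr_gt0//.
    apply: le_trans (_ : b / h <= _); last exact/ltW/truncnS_gt.
    by rewrite ler_pM2r ?invr_gt0.
  move: xN; rewrite ler_norml => /andP[Nx xN].
  have f1 : - Posz N <= Num.floor (x / h) by rewrite floor_ge_int mulrNz.
  have f2 : Num.floor (x / h) <= Posz N.
    by rewrite -(ler_int R) (le_trans (floor_le _)).
  apply/mapP; exists (absz (Num.floor (x / h) + Posz N)); last first.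
    by rewrite gez0_abs ?addrK// -lerBlDr sub0r.
  rewrite mem_iota add0n /= ltnS -lez_nat gez0_abs -?lerBlDr ?sub0r//.
  by rewrite PoszD lerD2r.
(* Both bounds are put as strict inequalities so that the level sets of p are built from the
   half-planes of [borel_Re_lt] and [borel_Im_lt]. *)
have floorE (x : R) (m : int) : (Num.floor (x / h) = m) <->
    (x < (m + 1)%:~R * h /\ ~ (x < m%:~R * h)).
  split=> [/eqP|[x1 /negP x2]].
    rewrite floor_eq ler_pdivlMr// ltr_pdivrMr// => /andP[x1 x2].
    by split=> //; apply/negP; rewrite -leNgt.
  by apply/eqP; rewrite floor_eq ler_pdivlMr// ltr_pdivrMr// x1 andbT leNgt.
have fp : finite_borel p.
  apply: (@finite_borel1 _ _ _ [seq (i, j) | i <- r, j <- r]).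
    move=> z; apply: allpairs_f; apply: inr.
      exact: le_trans (Re_le_rnorm _) (Fb z).
    exact: le_trans (Im_le_rnorm _) (Fb z).
  move=> [m n].
  rewrite [X in borel_set X](_ : _ = F @^-1` (
    ([set z | complex.Re z < (m + 1)%:~R * h] `\` [set z | complex.Re z < m%:~R * h]) `&`
    ([set z | complex.Im z < (n + 1)%:~R * h] `\` [set z | complex.Im z < n%:~R * h]))).
    apply: borel_fun_preimage => //; apply: borel_setI; apply: borel_setD;
      (exact: borel_Re_lt || exact: borel_Im_lt).
  apply/seteqP; split=> z /=.
    by move=> [/floorE ? /floorE ?].
  by move=> [/floorE e1 /floorE e2]; rewrite /p e1 e2.
exists ((fun k => (k.1%:~R * h) +i* (k.2%:~R * h))%C \o p).
  exact: finite_borel_comp.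
have floor_close (x : R) : `|(Num.floor (x / h))%:~R * h - x| <= h.
  have := floor_itv (x / h); rewrite ler_pdivlMr// ltr_pdivrMr// intrD => /andP[x1 x2].
  by rewrite ler_norml; move: x1 x2; lra.
move=> z; apply: le_trans (rnorm_le_ReIm _) _; rewrite !raddfB /=.
by rewrite [leRHS](splitr e) lerD// floor_close.
Qed.

Lemma is_integral_borel F (b : R) : borel_fun F -> (forall z, rnorm (F z) <= b) ->
  exists T, is_integral E F T.
Proof.
move=> bF Fb; apply: is_integral_exists => e e0.
exact: borel_fun_approx bF Fb e0.
Qed.

End Integral.

(** * Estimates on the imaginary axis *)

(** This is exp (i y), the form that [cexp] takes on the imaginary axis. *)
Definition cis (R : realType) (y : R) : R[i] := (cos y +i* sin y)%C.

Section Cis.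
Variable R : realType.
Implicit Types x y : R.

Lemma mean_value_at0 (f df : R -> R) y : (forall x, is_derive x 1 f (df x)) ->
  exists2 c, `|c| <= `|y| & f y - f 0 = df c * y.
Proof.
move=> fd; have fc (a b : R) : {within `[a, b], continuous f}.
  apply: continuous_subspaceT => x.
  by apply/differentiable_continuous/derivable1_diffP; apply: ex_derive; exact: fd.
have [y0|y0] := leP 0 y.
  have [c] := MVT_segment y0 (fun x _ => fd x) (fc 0 y).
  rewrite in_itv /= subr0 => /andP[c0 cy] ->.
  by exists c => //; rewrite !ger0_norm.
have [c] := MVT_segment (ltW y0) (fun x _ => fd x) (fc y 0).
rewrite in_itv /= sub0r mulrN => /andP[yc c0] fE.
exists c; first by rewrite !ler0_norm ?(ltW y0)// lerN2.
by rewrite -opprB fE opprK.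
Qed.

Lemma sin_le_norm y : `|sin y| <= `|y|.
Proof.
have [c _] := mean_value_at0 y (@is_derive_sin R).
by rewrite sin0 subr0 => ->; rewrite normrM ler_piMl// cos_max.
Qed.

(** The derivative -sin c is bounded by 1 and by |c| <= |y|. The linear bound leads to the Lipschitz
    estimate of [cis], the quadratic one to the second-order remainder [cis_sub1i_le]. *)
Lemma cos_sub1_le y : `|cos y - 1| <= `|y| /\ `|cos y - 1| <= `|y| ^+ 2.
Proof.
have [c cy] := mean_value_at0 y (@is_derive_cos R).
rewrite cos0 => ->; rewrite normrM normrN; split.
  by rewrite ler_piMl// sin_max.
by rewrite expr2 ler_wpM2r// (le_trans (sin_le_norm _)).
Qed.

Lemma sin_sub_le y : `|sin y - y| <= `|y| ^+ 2.
Proof.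
have [c cy] := @mean_value_at0 (fun y => sin y - y) (fun y => cos y - 1) y _.
rewrite sin0 !subr0 => ->; rewrite normrM expr2 ler_wpM2r//.
by apply: le_trans cy; case: (cos_sub1_le c).
Qed.

Lemma rnorm_cis y : rnorm (cis y) = 1.
Proof.
apply/eqP; rewrite -(@eqrXn2 _ 2) ?rnorm_ge0// expr1n rnorm_sqr /=.
by rewrite cos2Dsin2.
Qed.

Lemma cis0 : cis 0 = 1 :> R[i].
Proof. by rewrite /cis cos0 sin0. Qed.

Lemma cisD x y : cis (x + y) = cis x * cis y.
Proof.
by rewrite /cis cosD sinD; apply/eqP; rewrite eq_complex /= eqxx addrC eqxx.
Qed.

Lemma cis_sub1_le y : rnorm (cis y - 1) <= 2 * `|y|.
Proof.
apply: le_trans (rnorm_le_ReIm _) _; rewrite /= oppr0 addr0 mulr_natl mulr2n.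
by rewrite lerD ?sin_le_norm//; case: (cos_sub1_le y).
Qed.

Lemma cis_sub_le x y : rnorm (cis x - cis y) <= 2 * `|x - y|.
Proof.
rewrite -[x in cis x](subrK y) cisD -[X in _ - X]mul1r -mulrBl rnormM rnorm_cis mulr1.
exact: cis_sub1_le.
Qed.

Lemma cis_sub1i_le y : rnorm (cis y - 1 - 'i%C * toC y) <= 2 * `|y| ^+ 2.
Proof.
apply: le_trans (rnorm_le_ReIm _) _; rewrite /=.
rewrite !(mul0r, mul1r, mulr0, oppr0, addr0, subr0, add0r).
rewrite mulr_natl mulr2n lerD ?sin_sub_le//.
by case: (cos_sub1_le y).
Qed.

End Cis.

(** * Measurability of Lipschitz functions and their quotients *)

Section BorelLipschitz.
Variable R : realType.
Implicit Types (N : R[i] -> R[i]) (L : R).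

Lemma lipschitz_cvg N L (z : R[i]) : 0 <= L ->
  (forall v w, rnorm (N v - N w) <= L * rnorm (v - w)) ->
  (N w : (R[i])^o) @[w --> (z : (R[i])^o)] --> (N z : (R[i])^o).
Proof.
move=> L0 NL.
apply: (iffRL (@cvg_rnormP R (R[i])^o _ (nbhs (z : (R[i])^o)) _ N (N z))) => e e0.
have L1 : 0 < L + 1 by rewrite ltr_wpDl.
apply: (iffRL (@nbhs_normP _ (R[i])^o z _)).
exists (toC (e / (L + 1))); first by rewrite /= ltcR divr_gt0.
move=> w /=; rewrite rnormE ltcR ltr_pdivlMr// => zw.
apply: le_trans (NL _ _) _; apply: le_trans (ltW zw).
by rewrite mulrC ler_wpM2l ?rnorm_ge0// lerDl.
Qed.

Lemma cvg_rnorm_lt (F : R[i] -> R[i]) (z : R[i]) (e : R) :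
  (F w : (R[i])^o) @[w --> (z : (R[i])^o)] --> (F z : (R[i])^o) -> 0 < e ->
  exists2 r : R, 0 < r & forall w, rnorm (z - w) < r -> rnorm (F z - F w) < e.
Proof.
move=> /(iffLR (@cvg_rnormP R (R[i])^o _ (nbhs (z : (R[i])^o)) _ F (F z))) h e0.
have e20 : 0 < e / 2 by rewrite divr_gt0.
have /nbhs_normP[_ /= /gtc0_realE[r r0 ->] hr] := h _ e20.
exists r => // w zw; apply: le_lt_trans (_ : e / 2 < e).
  by apply: hr => /=; rewrite rnormE ltcR.
by rewrite ltr_pdivrMr// mulr_natr mulr2n ltrDl.
Qed.

Lemma borel_fun_lipschitz N L : 0 <= L ->
  (forall v w, rnorm (N v - N w) <= L * rnorm (v - w)) -> borel_fun N.
Proof.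
move=> L0 NL; rewrite (_ : N = fun z => N z * \1_setT z).
  apply: borel_fun_continuous_on; first by exists 1.
  move=> z e _; apply: cvg_rnorm_lt; exact: lipschitz_cvg NL.
by apply/funext => z; rewrite indicT mulr1.
Qed.

(* With 0^-1 = 0 the quotient is defined on the whole plane. *)
Lemma borel_fun_quotient N L (l : R[i]) : 0 <= L ->
  (forall v w, rnorm (N v - N w) <= L * rnorm (v - w)) ->
  borel_fun (fun z => N z * (z - l)^-1).
Proof.
move=> L0 NL.
rewrite (_ : (fun _ => _) =
    fun z => N z * (z - l)^-1 * \1_[set w | w != l] z).
  apply: borel_fun_continuous_on => z.
    move=> /= zl; exists (rnorm (z - l)).
      by rewrite lt_neqAle rnorm_ge0 andbT eq_sym rnorm_eq0 subr_eq0.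
    by move=> w zw; apply/eqP => wl; move: zw; rewrite wl ltxx.
  move=> e /= zl; apply: cvg_rnorm_lt.
  have c1 := @lipschitz_cvg N L z L0 NL.
  have c2 : (w - l : (R[i])^o) @[w --> (z : (R[i])^o)] --> (z - l : (R[i])^o).
    apply: (@lipschitz_cvg (fun w => w - l) 1) => // v w.
    by rewrite mul1r opprB addrA subrK.
  have zl0 : z - l != 0 by rewrite subr_eq0.
  exact: (cvgM c1 (cvgV zl0 c2)).
apply/funext => z; rewrite indicE.
have [->|zl] := eqVneq z l; first by rewrite subrr invr0 mulr0 mul0r.
by rewrite mem_set ?mulr1.
Qed.

End BorelLipschitz.

(** * The spectrum *)

Lemma bounded_linear_cvg (R : realType) (X : normedModType R[i]) (T : X -> X)
    (I : Type) (F : set_system I) {FF : Filter F} (u : I -> X) (l : X) :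
  bounded_linear T -> u @ F --> l -> T (u i) @[i --> F] --> T l.
Proof.
move=> /bounded_linearP[lT [b b0 Tb]] /cvg_rnormP ul; apply/cvg_rnormP => e e0.
have b1 : 0 < b + 1 by rewrite ltr_wpDl.
have := ul _ (divr_gt0 e0 b1); apply: filterS => i.
rewrite ler_pdivlMr// mulrDr mulr1 => ui; rewrite -(linear_funB _ _ lT).
apply: le_trans (Tb _) _; apply: le_trans ui.
by rewrite mulrC lerDl rnorm_ge0.
Qed.

Section SpectralOperator.
Variables (R : realType) (X : completeNormedModType R[i]).
Variable E : set R[i] -> X -> X.
Hypothesis hE : spectral_measure E.
Implicit Types (d : set R[i]) (f : X) (F G H s t : R[i] -> R[i]) (S T U : X -> X).

Lemma is_integral_ext F G T : (forall z, F z = G z) ->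
  is_integral E F T -> is_integral E G T.
Proof. by move=> /funext ->. Qed.

Let disk (n : nat) : set R[i] := [set w : R[i] | `|w| <= n%:R].

Let diskE n w : disk n w <-> rnorm w <= n%:R.
Proof. by rewrite /disk /= rnormE -(rmorph_nat (real_complex R)) lecR. Qed.

Lemma borel_disk (n : nat) : borel_set [set w : R[i] | `|w| <= n%:R].
Proof.
rewrite [X in borel_set X](_ : _ = [set w : R[i] | rnorm (w - 0) <= n%:R]).
  exact: borel_cball.
by apply/seteqP; split=> w /=; rewrite subr0 => /diskE.
Qed.

(** The disks increase to the whole plane, where E is the identity. Through this limit statements
    about A reduce to bounded functions. *)
Lemma disk_cvg f :
  E [set w : R[i] | `|w| <= n%:R] f @[n --> \oo] --> f.
Proof.
have nd : nondecreasing_seq disk.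
  move=> m n mn; rewrite subsetEset => z /diskE zm; apply/diskE.
  by apply: le_trans zm _; rewrite ler_nat.
have := @spectral_cvg _ _ _ hE disk f borel_disk nd.
rewrite (_ : \bigcup_n _ = setT) ?(spectral_measureT hE)//.
apply/seteqP; split=> // z _; exists (Num.truncn (rnorm z)).+1 => //.
by apply/diskE/ltW; exact: truncnS_gt.
Qed.

(** Once n exceeds a bound of |F|, truncation leaves F unchanged, so the defining sequence is
    eventually constant. *)
Lemma spectral_integral_bounded F T : is_integral E F T ->
  dom (spectral_integral E F) = setT /\ forall f, spectral_integral E F f = T f.
Proof.
move=> hT; have [b b0 Fb] := is_integral_bounded hT.
have cv f : bounded_integral E (truncation F n) f @[n --> \oo] --> T f.
  apply: cvg_near_cst; exists (Num.truncn b).+1 => // n /= bn.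
  rewrite (_ : truncation F n = F) ?(bounded_integralE hE hT)//.
  apply/funext => z; rewrite /truncation indicE mem_set ?mulr1//=.
  rewrite rnormE -(rmorph_nat (real_complex R)) lecR.
  apply: le_trans (Fb z) (le_trans (ltW (truncnS_gt _)) _).
  by rewrite ler_nat.
split; last by move=> f; exact: cvg_lim (cv f).
by apply/seteqP; split=> // f _; apply/cvg_ex; exists (T f).
Qed.

Lemma is_integral_indicM F T d : is_integral E F T -> borel_set d ->
  is_integral E (fun z => \1_d z * F z) (fun f => E d (T f)).
Proof. by move=> hT bd; apply: is_integralM => //; exact: is_integral_indic. Qed.

(* By disk_cvg it is enough to consider a vector in the range of E (disk n). *)
Lemma is_integral_cvg (I : Type) (P : set_system I) (FP : Filter P)
    (G : I -> R[i] -> R[i]) (S : I -> X -> X) H U (b : R) f :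
  (forall i, is_integral E (G i) (S i)) -> is_integral E H U ->
  (forall i z, rnorm (G i z) <= b) ->
  (forall (n : nat) (e : R), 0 < e -> \forall i \near P, forall z,
     rnorm z <= n%:R -> rnorm (G i z - H z) <= e) ->
  S i f @[i --> P] --> U f.
Proof.
move=> hS hU Gb GH; apply/cvg_rnormP => e e0.
have [C C0 hC] := is_integral_norm hE.
have [c c0 Hc] := is_integral_bounded hU.
pose k := C * (b + c) + 1.
(* The sign of b is known only once an index i is at hand. Any i gives 0 < k, so for k <= 0 the
   claim at i is vacuous. *)
have b0 (i : I) : 0 <= b := le_trans (rnorm_ge0 _) (Gb i 0).
have [k0|k0] := ltP 0 k; last first.
  have := GH 0%N _ e0; apply: filterS => i _.
  move: k0; rewrite leNgt => /negP[].
  by rewrite ltr_wpDl// mulr_ge0// addr_ge0// (b0 i).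
clear b0; have e20 : 0 < e / 2 by rewrite divr_gt0.
have /cvg_rnormP/(_ _ (divr_gt0 e20 k0))[n _ /(_ n (leqnn n)) /=] := @disk_cvg f.
rewrite -/(disk n) ler_pdivlMr// => fn.
have l0 : 0 < C * rnorm f + 1 by rewrite ltr_wpDl// mulr_ge0// rnorm_ge0.
have := GH n _ (divr_gt0 e20 l0); apply: filterS => i GHi.
have lS := is_integral_linear (hS i); have lU := is_integral_linear hU.
have D1 := is_integralB hE hU (hS i).
have D2 := is_integralM hE D1 (is_integral_indic hE (borel_disk n)).
(* On the small vector f - E (disk n) f the crude bound b + c on H - G i suffices; on E (disk n) f
   only values in the disk count, and there G i is close to H. *)
have -> : U f - S i f = (U (f - E (disk n) f) - S i (f - E (disk n) f)) +
    (U (E (disk n) f) - S i (E (disk n) f)).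
  rewrite (linear_funB _ _ lU) (linear_funB _ _ lS) opprB [RHS]addrACA subrK.
  by rewrite [S i (E _ f) - _]addrC addrK.
apply: le_trans (ler_rnormD _ _) _.
have h1 : rnorm (U (f - E (disk n) f) - S i (f - E (disk n) f)) <= e / 2.
  apply: le_trans (hC _ _ (b + c) (f - E (disk n) f) D1 _) _.
    move=> z; apply: le_trans (ler_rnormB _ _) _.
    by have := Gb i z; have := Hc z; lra.
  have := rnorm_ge0 (f - E (disk n) f).
  by move: fn; rewrite /k; lra.
have h2 : rnorm (U (E (disk n) f) - S i (E (disk n) f)) <= e / 2.
  apply: le_trans (hC _ _ (e / 2 / (C * rnorm f + 1)) f D2 _) _.
    move=> z; rewrite indicE; have [zn|zn] := boolP (z \in disk n).
      rewrite mulr1 rdistC; apply: GHi; apply/diskE.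
      exact: set_mem.
    by rewrite mulr0 rnorm0 divr_ge0// ltW.
  rewrite mulrAC mulrCA ler_piMr ?(ltW e20)// ler_pdivrMr// mul1r.
  by rewrite lerDl.
by rewrite [leRHS](splitr e) lerD.
Qed.

Lemma truncation_id_integral (n : nat) :
  is_integral E (truncation id n) (bounded_integral E (truncation id n)).
Proof.
have [T hT] : exists T, is_integral E (truncation id n) T.
  apply: (@is_integral_borel _ _ _ hE _ n%:R).
    by apply: borel_fun_indicM; [exact: borel_fun_id|exact: borel_disk].
  move=> z; rewrite /truncation indicE; have [zn|zn] := boolP (z \in _).
    by rewrite mulr1; apply/diskE; exact: set_mem.
  by rewrite mulr0 rnorm0.
by rewrite (bounded_integralE hE hT).
Qed.

Section UnboundedOperator.
Variable A : operator X.
Hypothesis hA : eq_operator A (spectral_integral E id).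

Let J (n : nat) := bounded_integral E (truncation id n).

Let domA f : dom A f <-> cvg (J n f @[n --> \oo]).
Proof. by have [-> _] := hA. Qed.

Let limA f : dom A f -> J n f @[n --> \oo] --> A f.
Proof. by move=> fA; have [_ ->//] := hA; exact/domA. Qed.

Let cvgA f g : J n f @[n --> \oo] --> g -> dom A f /\ A f = g.
Proof.
move=> h; have fA : dom A f by apply/domA/cvg_ex; exists g.
by split=> //; apply: cvg_unique (limA fA) h.
Qed.

(** * Compositions of A with integrals of bounded functions *)

Section Compose.
Variables (G H : R[i] -> R[i]) (S U : X -> X).
Hypotheses (hS : is_integral E G S) (hU : is_integral E H U).
Hypothesis HG : forall z, H z = G z * z.

(** J n (S f) is the integral of z G(z) = H(z) over the disk, that is E (disk n) (U f), and this
    tends to U f. *)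
Lemma operator_integral f : dom A (S f) /\ A (S f) = U f.
Proof.
apply: cvgA; rewrite (_ : (fun n => _) = fun n => E (disk n) (U f)).
  exact: disk_cvg.
apply/funext => n.
have := is_integral_unique hE (is_integralM hE (truncation_id_integral n) hS)
  (is_integral_ext _ (is_integral_indicM hU (borel_disk n))).
move/(_ _)/(congr1 (fun T => T f)); apply=> z.
by rewrite HG /truncation mulrCA mulrC [_ * z]mulrC.
Qed.

(** S (J n f) tends to S (A f) because S is bounded; it also equals E (disk n) (U f), which tends to
    U f. *)
Lemma integral_operator f : dom A f -> S (A f) = U f.
Proof.
move=> fA.
have [bS _] := hS.
have h1 : S (J n f) @[n --> \oo] --> S (A f).
  by apply: bounded_linear_cvg bS _; exact: limA.
rewrite -(cvg_lim _ h1)//; apply: cvg_lim => //.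
rewrite (_ : (fun n => _) = fun n => E (disk n) (U f)); first exact: disk_cvg.
apply/funext => n.
have := is_integral_unique hE (is_integralM hE hS (truncation_id_integral n))
  (is_integral_ext _ (is_integral_indicM hU (borel_disk n))).
move/(_ _)/(congr1 (fun T => T f)); apply=> z.
by rewrite HG /truncation mulrC -mulrA.
Qed.

End Compose.

(** On the range of E d, d the disk of radius r around l, A - l has norm at most C r, while Q, of
    norm at most q, undoes it. Hence |E d f| <= q C r |E d f|, and r is chosen so that q C r <=
    1/2. *)
Let resolvent_set_null (l : R[i]) : (~` spectrum A) l ->
  exists2 r : R, 0 < r & forall f, E [set w : R[i] | rnorm (w - l) < r] f = 0.
Proof.
rewrite /spectrum setCK => -[Q [/bounded_linearP[lQ [q q0 Qq]] _ QA]].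
have [C C0 hC] := is_integral_norm hE.
pose r := (2 * (q * C + 1))^-1.
have qC : 0 < q * C + 1 by rewrite ltr_wpDl// mulr_ge0.
have r0 : 0 < r by rewrite invr_gt0 mulr_gt0.
exists r => // f; set d := [set w | _].
have bd : borel_set d by exact: borel_ball.
have i1 := is_integral_indic hE bd.
have [T hT] : exists T, is_integral E (fun z => z * \1_d z) T.
  apply: (@is_integral_borel _ _ _ hE _ (rnorm l + r)).
    by apply: borel_fun_indicM => //; exact: borel_fun_id.
  move=> z; rewrite indicE; have [zd|zd] := boolP (z \in d).
    rewrite mulr1; have := set_mem zd; rewrite /d /=.
    by have := ler_rnorm_sub z l; lra.
  by rewrite mulr0 rnorm0 addr_ge0 ?rnorm_ge0// ltW.
have Hz z : z * \1_d z = \1_d z * z by rewrite mulrC.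
have [dA AE] := operator_integral i1 hT Hz f.
have := QA _ dA; rewrite AE => QE.
have D := is_integralB hE hT (is_integralZ hE l i1).
have h1 := hC _ _ r (E d f) D; have h2 := Qq (T f - l *: E d f).
rewrite QE in h2.
have TE : T (E d f) = T f.
  have := is_integral_unique hE (is_integralM hE hT i1) (is_integral_ext _ hT).
  move/(_ _)/(congr1 (fun T => T f)); apply=> z.
  by rewrite -mulrA !indicE -natrM mulnb andbb.
rewrite TE (spectral_measure_proj hE bd) in h1.
apply/eqP; rewrite -rnorm_eq0 eq_le rnorm_ge0 andbT.
have {h1} : rnorm (T f - l *: E d f) <= C * r * rnorm (E d f).
  apply: h1 => z; rewrite -mulrBl indicE; have [zd|zd] := boolP (z \in d).
    by rewrite mulr1; exact: ltW (set_mem zd).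
  by rewrite mulr0 rnorm0 ltW.
move/(ler_wpM2l q0) => h1; have {h1 h2} := le_trans h2 h1.
have -> : q * (C * r * rnorm (E d f)) = (q * C) * r * rnorm (E d f) by ring.
have : (q * C) * r <= 2^-1.
  rewrite /r invfM mulrCA -[leRHS]mulr1 ler_wpM2l// ler_pdivrMr// mul1r.
  by rewrite lerDl.
move/(ler_wpM2r (rnorm_ge0 (E d f))); lra.
Qed.

(** The resolvent is the integral of 1 / (z - l) outside the null disk, where this function is
    bounded by 1 / r. *)
Let null_resolvent_set (l : R[i]) (r : R) : 0 < r ->
  (forall f, E [set w : R[i] | rnorm (w - l) < r] f = 0) -> (~` spectrum A) l.
Proof.
move=> r0; set d := [set w | _] => d0.
have bd : borel_set d by exact: borel_ball.
have i1 := is_integral_indic hE (borel_setC bd).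
(* The factor 1 is the numerator N expected by [borel_fun_quotient], with Lipschitz constant 0. *)
pose G z := 1 * (z - l)^-1 * \1_(~` d) z.
have [Q hQ] : exists Q, is_integral E G Q.
  apply: (@is_integral_borel _ _ _ hE _ r^-1).
    apply: borel_fun_indicM; last exact: borel_setC.
    by apply: (@borel_fun_quotient _ (fun=> 1) 0) => // *; rewrite subrr rnorm0 mul0r.
  move=> z; rewrite /G indicE; have [zd|_] := boolP (z \in ~` d); last first.
    by rewrite mulr0 rnorm0 invr_ge0 ltW.
  have {zd} : r <= rnorm (z - l) by have /negP := set_mem zd; rewrite -leNgt.
  move=> rz; rewrite mul1r mulr1 rnormV lef_pV2 ?posrE//.
  exact: lt_le_trans rz.
have hU := is_integralD hE i1 (is_integralZ hE l hQ).
have HG z : \1_(~` d) z + l * G z = G z * z.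
  rewrite /G mul1r indicE; have [zd|_] := boolP (z \in ~` d); last first.
    by rewrite !mulr0 addr0 mul0r.
  have zl : z - l != 0.
    apply/eqP => zl; have := set_mem zd; rewrite /d /= zl rnorm0.
    exact.
  apply: (mulfI zl); rewrite !mulr1 mulrDr mulr1 mulrCA mulfV// mulr1 subrK.
  by rewrite mulrA mulfV// mul1r.
have EC f : E (~` d) f = f by rewrite spectralC// d0 subr0.
rewrite /spectrum setCK; exists Q; split.
- by case: hQ.
- move=> f; have [h ->] := operator_integral hQ hU HG f.
  by split=> //; rewrite EC addrK.
- move=> f fA; have lQ := is_integral_linear hQ.
  rewrite (linear_funB _ _ lQ) (linear_funZ _ _ lQ).
  by rewrite (integral_operator hQ hU HG fA) EC addrK.
Qed.

(** In other words, the spectrum, defined here through resolvents, is the support of E. *)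
Let resolvent_setP (l : R[i]) : (~` spectrum A) l <->
  exists2 r : R, 0 < r & forall f, E [set w : R[i] | rnorm (w - l) < r] f = 0.
Proof. by split=> [/resolvent_set_null//|[r r0 /(null_resolvent_set r0)]]. Qed.

Let null_subball (l c : R[i]) (r q : R) :
  (forall w, rnorm (w - c) < q -> rnorm (w - l) < r) ->
  (forall f, E [set w : R[i] | rnorm (w - l) < r] f = 0) ->
  (forall f, E [set w : R[i] | rnorm (w - c) < q] f = 0).
Proof.
move=> cl; apply: (@spectral_null _ _ _ hE); first exact: borel_ball.
  exact: borel_ball.
exact: cl.
Qed.

Lemma borel_spectrum : borel_set (spectrum A).
Proof.
rewrite -[X in borel_set X]setCK; apply: borel_setC; apply: open_borel => l.
move=> /resolvent_setP[r r0 lr]; exists (r / 2); first by rewrite divr_gt0.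
move=> w lw; apply/resolvent_setP; exists (r / 2); first by rewrite divr_gt0.
apply: null_subball lr => v vw; apply: le_lt_trans (rdistD w _ _) _.
by move: vw lw; rewrite [rnorm (l - w)]rdistC; lra.
Qed.

Let grid_center (a b : int) (n : nat) : R[i] :=
  (a%:~R / n.+1%:R +i* (b%:~R / n.+1%:R))%C.

(** [pickle] enumerates the triples (a, b, n). The radius is 2 / (n + 1) because rounding down each
    coordinate costs less than 1 / (n + 1), so every point lies in some disk of each mesh. *)
Let grid_ball (k : nat) : set R[i] :=
  if unpickle k is Some (a, b, n) then
    [set w : R[i] | rnorm (w - grid_center a b n) < 2 / n.+1%:R]
  else set0.

(** The whole disk if it is null and empty otherwise, so that the union may run over all k without
    selecting indices. *)
Let null_grid_ball (k : nat) : set R[i] :=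
  [set z | grid_ball k z /\ forall f, E (grid_ball k) f = 0].

(* The resolvent set is open and locally null, hence covered by countably many
   null disks (Lindelof). *)
Lemma spectral_measure_spectrum f : E (spectrum A) f = f.
Proof.
have bg k : borel_set (grid_ball k).
  rewrite /grid_ball; case: (unpickle k) => [[[a b] n]|]; last exact: borel_set0.
  exact: borel_ball.
have ngE k : (null_grid_ball k = grid_ball k /\ forall f, E (grid_ball k) f = 0) \/
    null_grid_ball k = set0.
  have [h|h] := pselect (forall f, E (grid_ball k) f = 0); [left|right].
    by split=> //; apply/seteqP; split=> z; [case|].
  by apply/seteqP; split=> z // [].
have bn k : borel_set (null_grid_ball k).
  by case: (ngE k) => [[-> _]|->]; [exact: bg|exact: borel_set0].
have n0 k g : E (null_grid_ball k) g = 0.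
  by case: (ngE k) => [[-> ->]|->]//; exact: spectral_measure0.
have bC : borel_set (~` spectrum A) by apply: borel_setC; exact: borel_spectrum.
have sub : ~` spectrum A `<=` \bigcup_k null_grid_ball k.
  move=> l /resolvent_setP[r r0 lr].
  (* Two points of a grid disk are less than 4 / (n + 1) <= r apart, so a grid disk containing l
     lies inside the null disk around l. *)
  have [n hn] := exists_invS_le (divr_gt0 r0 (ltr0n R 4)).
  have n0' : 0 < n.+1%:R :> R by [].
  pose a := Num.floor (complex.Re l * n.+1%:R).
  pose b := Num.floor (complex.Im l * n.+1%:R).
  have close (x : R) : `|x - (Num.floor (x * n.+1%:R))%:~R / n.+1%:R| < n.+1%:R^-1.
    have /andP[] := floor_itv (x * n.+1%:R); rewrite intrD.
    set m := Num.floor _; rewrite -ler_pdivrMr// => x1.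
    rewrite -ltr_pdivlMr// mulrDl mul1r => x2.
    by rewrite ger0_norm ?subr_ge0// ltrBlDl.
  have lc : rnorm (l - grid_center a b n) < 2 / n.+1%:R.
    apply: le_lt_trans (rnorm_le_ReIm _) _; rewrite !raddfB /=.
    by rewrite mulr_natl mulr2n ltrD ?close.
  have [k kE] : exists k, grid_ball k =
      [set w : R[i] | rnorm (w - grid_center a b n) < 2 / n.+1%:R].
    by exists (pickle (a, b, n)); rewrite /grid_ball pickleK.
  exists k => //; split; rewrite kE//.
  apply: null_subball lr => w wc; apply: le_lt_trans (rdistD (grid_center a b n) _ _) _.
  move: wc lc hn; rewrite [rnorm (l - _)]rdistC /=.
  move: (rnorm (w - _)) (rnorm (_ - l)) (n.+1%:R^-1) => u v i; lra.
have := spectralC hE f bC; rewrite setCK => ->.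
rewrite (spectral_null hE bC (borel_bigcup bn) sub) ?subr0//.
exact: spectral_null_bigcup.
Qed.

End UnboundedOperator.
End SpectralOperator.

(** * The group and its generator *)

Section ExpGroup.
Variables (R : realType) (X : completeNormedModType R[i]).
Variables (A : operator X) (E : set R[i] -> X -> X).
Hypothesis hE : spectral_measure E.
Hypothesis hA : eq_operator A (spectral_integral E id).
Hypothesis hsigma : spectrum A `<=` [set l | complex.Re l = 0].
Implicit Types (t h : R) (z : R[i]) (f g : X).

Let expF t z : R[i] := cexp (toC t * z) * \1_(spectrum A) z.

Let S t := bounded_integral E (expF t).

Let bsigma : borel_set (spectrum A) := borel_spectrum hE hA.

Let expFE t z : expF t z = cis (t * complex.Im z) * \1_(spectrum A) z.
Proof.
rewrite /expF indicE; have [/set_mem zs|_] := boolP (z \in spectrum A); last by rewrite !mulr0.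
congr (_ * _); have := hsigma zs; case: z zs => a b _ /= ->.
by rewrite /cexp /cis /= !mulr0 mul0r subr0 addr0 expR0 !mul1r.
Qed.

Let rnorm_spectrum z : spectrum A z -> rnorm z = `|complex.Im z|.
Proof.
move=> /hsigma /= z0; apply/eqP; rewrite -(@eqrXn2 _ 2) ?rnorm_ge0//.
by rewrite rnorm_sqr z0 expr0n add0r real_normK ?num_real.
Qed.

Let spectrum_imaginary z : spectrum A z -> z = 'i%C * toC (complex.Im z).
Proof.
move=> /hsigma /= z0; rewrite [LHS]complexE z0.
by rewrite (_ : toC 0 = 0)// add0r.
Qed.

Let borel_cis t : borel_fun (fun z => cis (t * complex.Im z)).
Proof.
apply: (@borel_fun_lipschitz _ _ (2 * `|t|)); first by rewrite mulr_ge0.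
move=> v w; apply: le_trans (cis_sub_le _ _) _.
rewrite -mulrBr normrM -mulrA ler_wpM2l// ler_wpM2l// -raddfB.
exact: Im_le_rnorm.
Qed.

Let rnorm_expF t z : rnorm (expF t z) <= 1.
Proof.
rewrite expFE indicE rnormM rnorm_cis mul1r.
by case: (z \in _); rewrite ?rnorm1 ?rnorm0.
Qed.

Let S_integral t : is_integral E (expF t) (S t).
Proof.
have [T hT] : exists T, is_integral E (expF t) T.
  apply: (@is_integral_borel _ _ _ hE _ 1); last exact: rnorm_expF.
  rewrite (_ : expF t = fun z => cis (t * complex.Im z) * \1_(spectrum A) z).
    exact: borel_fun_indicM.
  by apply/funext => z; rewrite expFE.
by rewrite /S (bounded_integralE hE hT).
Qed.

(** As E is carried by the spectrum, the identity is represented by a function vanishing off it. All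
    comparisons of functions thus take place on the imaginary axis. *)
Let one_integral : is_integral E \1_(spectrum A) (fun f => f).
Proof.
have := is_integral_indic hE bsigma.
by rewrite (_ : E (spectrum A) = fun f => f)//; apply/funext => f;
   exact: (spectral_measure_spectrum hE hA).
Qed.

Lemma exp_operatorE t :
  dom (exp_operator A E t) = setT /\ forall f, exp_operator A E t f = S t f.
Proof. exact: (spectral_integral_bounded hE (S_integral t)). Qed.

Let S0 f : S 0 f = f.
Proof.
have h : is_integral E (expF 0) (fun f => f).
  apply: is_integral_ext one_integral => z.
  by rewrite expFE mul0r cis0 mul1r.
by rewrite (is_integral_unique hE (S_integral 0) h).
Qed.

Let SD s t f : S (s + t) f = S s (S t f).
Proof.
have h : is_integral E (expF (s + t)) (fun f => S s (S t f)).
  apply: is_integral_ext (is_integralM hE (S_integral s) (S_integral t)) => z.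
  rewrite !expFE mulrDl cisD mulrACA; congr (_ * _).
  by rewrite !indicE -natrM mulnb andbb.
by rewrite (is_integral_unique hE (S_integral _) h).
Qed.

Lemma exp_operator_bounded : exists2 C : R, 0 <= C &
  forall t f, rnorm (exp_operator A E t f) <= C * rnorm f.
Proof.
have [C C0 hC] := is_integral_norm hE.
exists C => // t f; have [_ ->] := exp_operatorE t.
by rewrite -[C]mulr1; exact: (hC _ _ 1 f (S_integral t) (rnorm_expF t)).
Qed.

(** For |z| <= n the functions at s and t differ by at most 2 n |s - t|, which is the locally
    uniform convergence that [is_integral_cvg] asks for. *)
Let S_continuous f : continuous (fun t => S t f).
Proof.
move=> t; apply: (@is_integral_cvg _ _ _ hE _ (nbhs t) _ expF S (expF t) (S t) 1).
- exact: S_integral.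
- exact: S_integral.
- exact: rnorm_expF.
move=> n e e0.
have n0 : 0 < 2 * (n%:R + 1) :> R by rewrite mulr_gt0// ltr_wpDl.
have /cvgrPdist_le/(_ _ (divr_gt0 e0 n0)) := @cvg_id _ (nbhs t).
apply: filterS => s; rewrite ler_pdivlMr// => st z zn.
rewrite !expFE -mulrBl indicE; case: (z \in _); last by rewrite mulr0 rnorm0 ltW.
rewrite mulr1; apply: le_trans (cis_sub_le _ _) _.
rewrite -mulrBl normrM distrC; apply: le_trans st.
rewrite mulrCA ler_wpM2l// ler_wpM2l//.
apply: le_trans (Im_le_rnorm z) (le_trans zn _).
by rewrite lerDl.
Qed.

Lemma exp_operator_c0_group : c0_group (exp_operator A E).
Proof.
have TE t : exp_operator A E t = S t :> (X -> X).
  by apply/funext => f; have [_] := exp_operatorE t.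
split.
- move=> t; split; first by have [] := exp_operatorE t.
  by rewrite TE; have [] := S_integral t.
- by move=> f; rewrite TE S0.
- move=> s t f; have TEf r g := congr1 (fun T => T g) (TE r).
  apply: etrans (TEf (s + t) f) (etrans (SD s t f) _).
  exact: esym (etrans (TEf s _) (congr1 (S s) (TEf t f))).
- move=> f; rewrite (_ : (fun t => _) = fun t => S t f); first exact: S_continuous.
  by apply/funext => t; have [_] := exp_operatorE t.
Qed.

Let quotF h z : R[i] := (toC h)^-1 * (expF h z - \1_(spectrum A) z).

Let quotS h f := (toC h)^-1 *: (S h f - f).

Let quot_integral h : is_integral E (quotF h) (quotS h).
Proof. exact: (is_integralZ hE _ (is_integralB hE (S_integral h) one_integral)). Qed.

(** With 0^-1 = 0 the product is 0 at x = 0, so that [rnorm_divF] covers h = 0 and z = 0 as well. *)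
Let mulV_le1 (x : R) : 0 <= x -> x * x^-1 <= 1.
Proof.
by have [->|x0] := eqVneq x 0; rewrite ?mul0r// divff.
Qed.

(** Written with z - 0 to match [borel_fun_quotient] at l = 0; the value at z = 0 is 0. *)
Let divF h z : R[i] := (toC h)^-1 * (cis (h * complex.Im z) - 1) * (z - 0)^-1.

Let rnorm_divF h z : rnorm (divF h z) <= 2.
Proof.
rewrite /divF subr0 !rnormM !rnormV rnorm_toC.
have h1 := cis_sub1_le (h * complex.Im z); rewrite normrM in h1.
have h2 : rnorm (cis (h * complex.Im z) - 1) <= 2 * (`|h| * rnorm z).
  apply: le_trans h1 _; rewrite ler_wpM2l// ler_wpM2l//; exact: Im_le_rnorm.
apply: le_trans (_ : `|h|^-1 * (2 * (`|h| * rnorm z)) * (rnorm z)^-1 <= _).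
  by rewrite ler_wpM2r ?invr_ge0 ?rnorm_ge0// ler_wpM2l ?invr_ge0.
rewrite [leLHS](_ : _ = 2 * ((`|h| * `|h|^-1) * (rnorm z * (rnorm z)^-1))); last first.
  by move: (`|h|^-1) (rnorm z)^-1 => u v; ring.
rewrite -[leRHS]mulr1 ler_wpM2l//.
by rewrite mulr_ile1 ?mulV_le1 ?rnorm_ge0// mulr_ge0 ?invr_ge0 ?rnorm_ge0.
Qed.

(* (exp (h z) - 1) / (h z) on the spectrum, with its limit value 1 at z = 0. *)
Let kernelF h z : R[i] :=
  divF h z * \1_(spectrum A) z + \1_([set 0] `&` spectrum A) z.

Let rnorm_kernelF h z : rnorm (kernelF h z) <= 3.
Proof.
apply: le_trans (ler_rnormD _ _) _.
have -> : 3 = 2 + 1 :> R by rewrite natr1.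
rewrite rnormM !indicE; apply: lerD.
  by case: (z \in _); rewrite ?rnorm1 ?rnorm0 ?mulr1 ?mulr0 ?rnorm_divF.
by case: (z \in _); rewrite ?rnorm1 ?rnorm0.
Qed.

Let kernel_integral h : exists V, is_integral E (kernelF h) V.
Proof.
have b0 : borel_set ([set 0] `&` spectrum A).
  by apply: borel_setI => //; exact: borel_set1.
have [V hV] : exists V, is_integral E (fun z => divF h z * \1_(spectrum A) z) V.
  apply: (@is_integral_borel _ _ _ hE _ 2).
    apply: borel_fun_indicM => //.
    apply: (@borel_fun_quotient _ _ (`|h|^-1 * (2 * `|h|))).
      by rewrite mulr_ge0 ?invr_ge0// mulr_ge0.
    move=> v w; rewrite -mulrBr rnormM rnormV rnorm_toC -!mulrA.
    rewrite ler_wpM2l ?invr_ge0// opprB addrA subrK.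
    apply: le_trans (cis_sub_le _ _) _.
    rewrite -mulrBr normrM ler_wpM2l// ler_wpM2l// -raddfB.
    exact: Im_le_rnorm.
  move=> z; rewrite rnormM indicE.
  by case: (z \in _); rewrite ?rnorm1 ?rnorm0 ?mulr1 ?mulr0 ?rnorm_divF.
by eexists; exact: (is_integralD hE hV (is_integral_indic hE b0)).
Qed.

Let kernel_quot h z : quotF h z = kernelF h z * z.
Proof.
rewrite /quotF /kernelF /divF expFE subr0 !indicE in_setI.
case: (z \in spectrum A); last by rewrite !mulr0 andbF subr0 mulr0 addr0 mul0r.
rewrite !mulr1 andbT; have [->|z0] := eqVneq z 0.
  by rewrite /= mulr0 cis0 subrr !mulr0.
rewrite (_ : (z \in [set 0]) = false) ?addr0 ?divfK//.
by apply/negP => /set_mem /= z1; rewrite z1 eqxx in z0.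
Qed.

Let cis_sub1z_le h z : spectrum A z ->
  rnorm (cis (h * complex.Im z) - 1 - toC h * z) <= 2 * (`|h| * rnorm z) ^+ 2.
Proof.
move=> zs; have -> : toC h * z = 'i%C * toC (h * complex.Im z).
  by rewrite {1}(spectrum_imaginary zs) rmorphM /= mulrCA.
by apply: le_trans (cis_sub1i_le _) _; rewrite normrM rnorm_spectrum.
Qed.

Let near0 (d : R) : 0 < d -> \forall h \near (0 : R)^', h != 0 /\ `|h| <= d.
Proof.
move=> d0; near=> h; split; near: h; first exact: nbhs_dnbhs_neq.
exact: dnbhs0_le.
Unshelve. all: by end_near. Qed.

(** For f in the domain the factor z of [kernel_quot] is absorbed into A f, leaving the kernels,
    bounded by 3, applied to a fixed vector. They tend to 1 uniformly on disks, with error at most 2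
    |h| |z| on the spectrum. *)
Let quot_cvg f : dom A f -> quotS h f @[h --> 0^'] --> A f.
Proof.
move=> fA; have /choice[V hV] := kernel_integral.
rewrite (_ : (fun h => quotS h f) = fun h => V h (A f)); last first.
  apply/funext => h; apply/esym.
  exact: (integral_operator hE hA (hV h) (quot_integral h) (kernel_quot h) fA).
apply: (@is_integral_cvg _ _ _ hE _ (0 : R)^' _ kernelF V \1_(spectrum A) (fun f => f) 3).
- exact: hV.
- exact: one_integral.
- exact: rnorm_kernelF.
move=> n e e0.
have n0 : 0 < 2 * (n%:R + 1) :> R by rewrite mulr_gt0// ltr_wpDl.
apply: filterS (near0 (divr_gt0 e0 n0)) => h [h0]; rewrite ler_pdivlMr// => he z zn.
rewrite /kernelF !indicE in_setI.
have [/set_mem zs|_] := boolP (z \in spectrum A); last first.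
  by rewrite !mulr0 andbF addr0 subr0 rnorm0 ltW.
rewrite mulr1 andbT; have [z0|z0] := eqVneq z 0.
  rewrite mem_set// /divF subr0 {2}z0 invr0 mulr0 add0r subrr rnorm0.
  exact: ltW.
rewrite (_ : (z \in [set 0]) = false) ?addr0; last first.
  by apply/negP => /set_mem /= z1; rewrite z1 eqxx in z0.
have hz0 : toC h * z != 0 by rewrite mulf_neq0// fmorph_eq0.
have -> : divF h z - 1 = (cis (h * complex.Im z) - 1 - toC h * z) / (toC h * z).
  rewrite /divF subr0 [RHS]mulrBl divff// invfM.
  by congr (_ - _); rewrite -mulrA mulrCA.
rewrite rnormM rnormV rnormM rnorm_toC.
have hz1 : 0 < `|h| * rnorm z.
  by rewrite mulr_gt0 ?normr_gt0// lt_neqAle rnorm_ge0 andbT eq_sym rnorm_eq0.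
rewrite ler_pdivrMr//; apply: le_trans (cis_sub1z_le _ zs) _.
rewrite expr2 mulrA ler_wpM2r ?(ltW hz1)//; apply: le_trans he.
rewrite mulrCA ler_wpM2l// ler_wpM2l// (le_trans zn)// lerDl//.
Qed.

(** Cut off to a disk, the difference quotient tends uniformly to z on the spectrum. Hence the
    truncated integral of z at f is E (disk n) g, which converges by [disk_cvg], and this is
    membership in the domain. *)
Let quot_dom f g : quotS h f @[h --> 0^'] --> g -> dom A f.
Proof.
move=> fg; have [-> _] := hA; apply/cvg_ex; exists g.
rewrite (_ : (fun n => _) = fun n : nat => E [set w : R[i] | `|w| <= n%:R] g).
  exact: disk_cvg.
apply/funext => n; set d := [set w | _].
have bd : borel_set d by exact: borel_disk.
have bdlin := spectral_measure_bounded hE bd.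
have h1 : E d (quotS h f) @[h --> 0^'] --> E d g.
  by apply: bounded_linear_cvg bdlin fg.
rewrite -(cvg_lim _ h1)//; apply/esym/cvg_lim => //.
have dn z : d z -> rnorm z <= n%:R.
  by rewrite /d /= rnormE -(rmorph_nat (real_complex R)) lecR.
(* The limit function carries the indicator of the spectrum, because [quotF] vanishes off it; its
   integral is the identity, so the limit operator is still the truncated integral of z. The bound 3
   n is that of the kernel times |z| <= n. *)
apply: (@is_integral_cvg _ _ _ hE _ (0 : R)^' _
  (fun h z => \1_d z * quotF h z) (fun h f => E d (quotS h f))
  (fun z => \1_(spectrum A) z * truncation id n z) _ (3 * n%:R)).
- by move=> h; apply: is_integral_indicM.
- exact: (is_integralM hE one_integral (truncation_id_integral hE n)).
- move=> h z; rewrite indicE; have [/set_mem zd|_] := boolP (z \in d); last first.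
    by rewrite mul0r rnorm0 mulr_ge0.
  by rewrite mul1r kernel_quot rnormM ler_pM ?rnorm_ge0// dn.
move=> m e e0.
have n0 : 0 < 2 * (n%:R + 1) ^+ 2 :> R.
  by rewrite mulr_gt0// exprn_gt0// ltr_wpDl.
apply: filterS (near0 (divr_gt0 e0 n0)) => h [h0]; rewrite ler_pdivlMr// => he z _.
rewrite /quotF expFE /truncation -/d !indicE.
have [/set_mem zs|_] := boolP (z \in spectrum A); last first.
  by rewrite mulr0 subrr !mulr0 mul0r subrr rnorm0 ltW.
have [/set_mem zd|_] := boolP (z \in d); last first.
  by rewrite !mulr0 mul0r subrr rnorm0 ltW.
rewrite !mul1r !mulr1.
have hh : toC h != 0 by rewrite fmorph_eq0.
have -> : (toC h)^-1 * (cis (h * complex.Im z) - 1) - z =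
    (toC h)^-1 * (cis (h * complex.Im z) - 1 - toC h * z).
  by rewrite [RHS]mulrBr mulKf.
rewrite rnormM rnormV rnorm_toC.
have hh0 : 0 < `|h| by rewrite normr_gt0.
rewrite ler_pdivrMl//; apply: le_trans (ler_wpM2l (ltW hh0) he).
apply: le_trans (cis_sub1z_le _ zs) _.
rewrite exprMn [leRHS]mulrA -expr2 mulrCA ler_wpM2l ?sqr_ge0// ler_wpM2l//.
by rewrite ler_pXn2r ?nnegrE ?rnorm_ge0 ?addr_ge0// (le_trans (dn _ zd))// lerDl.
Qed.

Lemma exp_operator_generator : eq_operator (generator (exp_operator A E)) A.
Proof.
have TE f : (fun h => toC h^-1 *: (exp_operator A E h f - f)) = fun h => quotS h f.
  by apply/funext => h; have [_ ->] := exp_operatorE h; rewrite /quotS fmorphV.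
split.
  apply/seteqP; split=> f /=; rewrite TE.
    by move=> /cvg_ex[g]; exact: quot_dom.
  by move=> fA; apply/cvg_ex; exists (A f); exact: quot_cvg.
move=> f /=; rewrite TE => /cvg_ex[g fg].
by apply: cvg_lim => //; apply: quot_cvg; exact: quot_dom fg.
Qed.

End ExpGroup.

(** The orbit of f stays in the ball of radius C |f|, so it misses the open set of vectors of larger
    norm, which contains (C + 1) f because f is nonzero. *)
Lemma bounded_not_hypercyclic (R : realType) (X : normedModType R[i]) (J : Type)
    (T : J -> operator X) (C : R) : 0 <= C ->
  (forall t f, rnorm (T t f) <= C * rnorm f) -> ~ hypercyclic T.
Proof.
move=> C0 TC [f [f0 _ df]].
have f1 : 0 < rnorm f by rewrite lt_neqAle rnorm_ge0 andbT eq_sym rnorm_eq0.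
have [] := df [set g | C * rnorm f < rnorm g].
- exists (toC (C + 1) *: f) => /=.
  by rewrite rnormZ rnorm_toC ger0_norm ?addr_ge0// ltr_pM2r// ltrDl.
- apply: (iffRL (open_rnormP _)) => g /= gC; exists (rnorm g - C * rnorm f).
    by rewrite subr_gt0.
  by move=> h; have := ler_rnorm_sub g h; lra.
- by move=> g [/= h [t _ tE]]; move: h; rewrite -tE ltNge TC.
Qed.

Theorem proposition3p1 (R : realType) (X : completeNormedModType R[i])
    (A : operator X) (E : set R[i] -> X -> X)
    (hA : scalar_type_spectral A E)
    (hsigma : spectrum A `<=` [set l | complex.Re l = 0]) :
  (c0_group (exp_operator A E) /\
   eq_operator (generator (exp_operator A E)) A) /\
  (ereal_sup [set opnorm (exp_operator A E t) | t in [set: R]] < +oo)%E /\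
  ~ hypercyclic (exp_operator A E).
Proof.
have [_ hE hAE] := hA.
have [C C0 hC] := exp_operator_bounded hE hAE hsigma.
split; first by split; [exact: exp_operator_c0_group|exact: exp_operator_generator].
split; last exact: bounded_not_hypercyclic hC.
apply: le_lt_trans (_ : C%:E < +oo)%E; last exact: ltry.
by apply: ge_ereal_sup => _ [t _ <-]; exact: opnorm_le.
Qed.
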